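(* Let $w\in\mathcal S(\mathbb R;\mathbb R)$, set $q=w'-w^2$, and write $I(w)=\int_{\mathbb R} w\,dx$. Then $H_q\ge 0$, the two zero-energy Jost solutions $f_-(\cdot,0)$ and $f_+(\cdot,0)$ of $H_q$ are linearly dependent, and \[ a_q(0)=\cosh I(w),\qquad b_q(0)=-\sinh I(w),\qquad T_q(0)=\operatorname{sech} I(w),\qquad R_q(0)=-\tanh I(w). \]
   Context: $\mathcal S(\mathbb R;\mathbb R)$ is the space of real-valued Schwartz functions on $\mathbb R$. For $q\in\mathcal S(\mathbb R;\mathbb R)$, $H_q=-\partial_x^2-q$ is the Schr\''odinger operator (note the sign of $q$), self-adjoint on $L^2(\mathbb R)$. For $\operatorname{Im}k\ge 0$ the Jost solutions $f_\pm(\cdot,k)$ are the solutions of $-y''-qy=k^2y$ fixed by $f_+(x,k)=e^{ikx}(1+o(1))$ as $x\to+\infty$ and $f_-(x,k)=e^{-ikx}(1+o(1))$ as $x\to-\infty$ (at $k=0$, $f_\pm(x,0)\to 1$ as $x\to\pm\infty$). For real $k\ne 0$ the scattering coefficients $a_q(k),b_q(k)$ are defined by \[ f_-(x,k)=a_q(k)f_+(x,-k)+b_q(k)f_+(x,k), \] and $T_q(k)=1/a_q(k)$, $R_q(k)=b_q(k)/a_q(k)$ are the transmission coefficient and the (right) reflection coefficient. Values at $k=0$ are understood as limits as $k\to 0$ along the real axis. *)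

(* Defs.v *)
From HB Require Import structures.
From mathcomp Require Import all_boot all_order all_algebra.
From mathcomp Require Import complex.
From mathcomp Require Import all_classical all_reals all_analysis.

Set Implicit Arguments.
Unset Strict Implicit.
Unset Printing Implicit Defensive.

Import Order.TTheory GRing.Theory Num.Theory.
Import numFieldNormedType.Exports.

Local Open Scope classical_set_scope.
Local Open Scope ring_scope.
Local Open Scope complex_scope.

Section RealFunctions.
Context {R : realType}.
Local Notation mu := (@lebesgue_measure R).

Definition cosh (x : R) : R := (expR x + expR (- x)) / 2.
Definition sinh (x : R) : R := (expR x - expR (- x)) / 2.
Definition sech (x : R) : R := (cosh x)^-1.
Definition tanh (x : R) : R := sinh x / cosh x.

Definition schwartz (f : R -> R) : Prop :=
  (forall (n : nat) (x : R), derivable (derive1n n f) x 1) /\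
  (forall m n : nat, exists C : R,
     forall x : R, `|x| ^+ m * `|derive1n n f x| <= C).

(* f is locally absolutely continuous with almost everywhere derivative g *)
Definition ac_derivative (f g : R -> R) : Prop :=
  forall a b : R, a <= b ->
    mu.-integrable `[a, b] (EFin \o g) /\
    f b - f a = \int[mu]_(x in `[a, b]) g x.

End RealFunctions.

(* R[i]^o carries the topology given by the complex modulus.  The library has no
   R-normed module structure on R[i], so differentiation and integration of
   functions R -> R[i] are taken on real and imaginary parts. *)
Section ComplexValued.
Context {R : realType}.
Local Notation C := R[i].
Local Notation reC := (@complex.Re R).
Local Notation imC := (@complex.Im R).
Local Notation mu := (@lebesgue_measure R).
Implicit Types (f g u v : R -> C) (z : C) (q : R -> R).

Definition cexp z : C :=
  (expR (reC z))%:C * (cos (imC z) +i* sin (imC z)).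

Definition cderivable f : Prop := forall x : R,
  derivable (reC \o f) x 1 /\ derivable (imC \o f) x 1.

Definition cderive f : R -> C := fun x =>
  derive1 (reC \o f) x +i* derive1 (imC \o f) x.

Definition cac_derivative f g : Prop :=
  ac_derivative (reC \o f) (reC \o g) /\
  ac_derivative (imC \o f) (imC \o g).

Definition L2 f : Prop :=
  reC \o f \in Lfun mu 2%:E /\ imC \o f \in Lfun mu 2%:E.

Definition cintegral f : C :=
  (\int[mu]_x reC (f x)) +i* (\int[mu]_x imC (f x)).

Definition inner u v : C := cintegral (fun x => (u x)^*%C * v x).

(* Unbounded operators on L^2(R) are given by their graphs, on representatives:
   [schrodinger q u v] says that u lies in the domain H^2(R) and that
   v = - u'' - q u, where u'' is an almost everywhere derivative of the
   locally absolutely continuous function u'. *)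
Definition schrodinger q u v : Prop :=
  exists u' u'' : R -> C,
    [/\ cac_derivative u u', cac_derivative u' u'',
        L2 u, L2 u' & L2 u''] /\
    v = (fun x => - u'' x - (q x)%:C * u x).

Definition nonnegative_operator (A : (R -> C) -> (R -> C) -> Prop) : Prop :=
  forall u v, A u v -> 0 <= inner u v.

Definition eigen_ode q (k : C) (y : R -> C) : Prop :=
  [/\ cderivable y, cderivable (cderive y) &
      forall x : R, - cderive (cderive y) x - (q x)%:C * y x = k ^+ 2 * y x].

(* For 0 <= Im k these conditions single out one solution when q is Schwartz;
   the value chosen for Im k < 0 is irrelevant. *)
Definition is_jost_plus q (k : C) f : Prop :=
  eigen_ode q k f /\
  cexp (- ('i%C * k * x%:C)) * f x @[x --> +oo%R] --> (1 : C^o).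

Definition is_jost_minus q (k : C) f : Prop :=
  eigen_ode q k f /\
  cexp ('i%C * k * x%:C) * f x @[x --> -oo%R] --> (1 : C^o).

Definition jost_plus q (k : C) : R -> C :=
  xget (fun=> 0) [set f | is_jost_plus q k f].

Definition jost_minus q (k : C) : R -> C :=
  xget (fun=> 0) [set f | is_jost_minus q k f].

(* The pair (a_q(k), b_q(k)); meaningful for k != 0. *)
Definition scattering q (k : R) : C * C :=
  xget (0, 0) [set ab : C * C | forall x : R,
    jost_minus q k%:C x =
    ab.1 * jost_plus q (- k)%:C x + ab.2 * jost_plus q k%:C x].

Definition coef_a q (k : R) : C := (scattering q k).1.
Definition coef_b q (k : R) : C := (scattering q k).2.
Definition transmission q (k : R) : C := (coef_a q k)^-1.
Definition reflection q (k : R) : C := coef_b q k / coef_a q k.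

Definition linearly_dependent f g : Prop :=
  exists c d : C, (c, d) <> (0, 0) /\ forall x : R, c * f x + d * g x = 0.

End ComplexValued.

(* Main.v *)
Require Import Defs.
From mathcomp Require Import all_boot all_order all_algebra.
From mathcomp Require Import complex.
From mathcomp Require Import all_classical all_reals all_analysis.
From mathcomp Require Import measurable_realfun ring lra.

Import Order.TTheory GRing.Theory Num.Theory.
Import numFieldNormedType.Exports.

Local Open Scope classical_set_scope.
Local Open Scope ring_scope.
Local Open Scope complex_scope.

(** Write q = w' - w^2.  The operator factorizes as H_q = A* A with
    A u = u' + w u, and this is used twice.

    Nonnegativity.  For u in the domain, conj u * H_q u equals |u' + w u|^2
    minus the derivative of conj u * u' + w |u|^2.  The latter function and its
    derivative are both integrable on the line, so that derivative has integral
    zero ([Rintegral_derivative]) and the quadratic form is the integral of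
    |u' + w u|^2 ([factorized_form]).  Since u' is only absolutely continuous,
    this rests on a product rule for such functions ([ac_derivative_mul]).

    Scattering.  For real k the equation - u'' - q u = k^2 u is the system
    u' = - w u + k v, v' = w v - k u.  In the frame rotating with frequency k,
    (u, v) is replaced by coordinates (alpha, beta) that solve a real linear
    system whose coefficients are w times a reflection matrix.  Those
    coefficients are integrable uniformly in k, so solutions exist with
    prescribed values at - oo, are bounded uniformly in k, and have limits at
    + oo ([linear_system_exists]).  The limits of alpha and beta are exactly
    the amplitudes of cos (k x) and sin (k x) in the asymptotics of u, so the
    matrix m sending the values at - oo to those at + oo determines the Jost
    solutions at both ends, and a and b are linear in its entries
    ([scattering_formula]).

    Low energy.  At k = 0 the reflection matrix becomes diag (-1, 1) and the
    system decouples into alpha' = - w alpha, beta' = w beta, whence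
    m = diag (exp (- I), exp I).  For k != 0, comparing alpha * exp S and
    beta * exp (- S), where S' = w, with constants gives an error O(|k|),
    because |x w(x)| is integrable ([small_frequency_limit]).  Thus a tends to
    (exp (- I) + exp I) / 2 = cosh I and b to (exp (- I) - exp I) / 2 = - sinh I.

    Zero energy.  The function exp (- S) is a positive solution bounded above
    and away from zero; any solution with a limit at one end is a multiple of
    it, since a second independent solution would grow linearly
    ([convergent_zero_energy_solution]).  Both zero-energy Jost solutions are
    such multiples. *)

(** * Complex limits in coordinates *)

Section ComplexLimits.
Context {R : realType}.
Local Notation reC := (@complex.Re R).
Local Notation imC := (@complex.Im R).

Lemma Re_mul (z t : R[i]) : reC (z * t) = reC z * reC t - imC z * imC t.
Proof. by case: z t => [a b] [c d]. Qed.

Lemma Im_mul (z t : R[i]) : imC (z * t) = reC z * imC t + imC z * reC t.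
Proof. by case: z t => [a b] [c d]. Qed.

Lemma norm_le_ReIm (z : R[i]) : (`|z| <= (`|reC z| + `|imC z|)%:C).
Proof.
rewrite {1}[z]complexE; move: (reC z) (imC z) => a b.
have nr (x : R) : `|x%:C| = `|x|%:C :> R[i].
  by rewrite normc_def /= expr0n /= addr0 sqrtr_sqr.
apply: le_trans (ler_normD _ _) _; rewrite normrM !nr.
have -> : `|('i%C : R[i])| = 1.
  by rewrite normc_def /= expr0n /= add0r expr1n sqrtr1.
by rewrite mul1r rmorphD.
Qed.

Lemma norm_ge_Im (z : R[i]) : `|imC z|%:C <= `|z|.
Proof.
rewrite normc_def lecR -sqrtr_sqr; apply: ler_wsqrtr.
by rewrite lerDr sqr_ge0.
Qed.

(** Reduces every limit of complex functions below to two real limits; it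
    holds because the modulus lies between each coordinate and the sum of
    both. *)
Lemma cvg_ReIm {T : Type} (F : set_system T) {FF : Filter F}
  (f : T -> R[i]) (l : R[i]) :
  f x @[x --> F] --> (l : R[i]^o) <->
  (reC (f x) @[x --> F] --> reC l) /\ (imC (f x) @[x --> F] --> imC l).
Proof.
have ReB (z t : R[i]) : reC (z - t) = reC z - reC t by case: z t => [? ?] [].
have ImB (z t : R[i]) : imC (z - t) = imC z - imC t by case: z t => [? ?] [].
split=> [h|[/cvgrPdist_lt hr /cvgrPdist_lt hi]].
  have h' := (@cvgrPdist_lt _ R[i]^o _ _ _ f l).1 h.
  split; apply/cvgrPdist_lt => e e0; have := h' FF e%:C;
    rewrite ltcR => /(_ e0); apply: filterS => x hx; rewrite -ltcR;
    apply: le_lt_trans hx.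
  - by rewrite -ReB; exact: normc_ge_Re.
  - by rewrite -ImB; exact: norm_ge_Im.
apply/(cvgrPdist_lt (V := R[i]^o) f l) => e e0.
have e0' : 0 < reC e / 2 by move: e0; rewrite ltcE /= => /andP[_]; lra.
near=> x.
apply: le_lt_trans (norm_le_ReIm _) _; rewrite ReB ImB.
have -> : e = (reC e)%:C.
  by move: e0; rewrite ltcE; case: (e) => a b /= /andP[/eqP -> _].
rewrite ltcR.
have h1 : `|reC l - reC (f x)| < reC e / 2 by near: x; exact: hr.
have h2 : `|imC l - imC (f x)| < reC e / 2 by near: x; exact: hi.
lra.
Unshelve. all: by end_near. Qed.

End ComplexLimits.

(** * Comparing functions through their derivatives *)

Section Comparison.
Context {R : realType}.
Implicit Types f g h : R -> R.

Lemma is_derive_continuous f (f' : R -> R) :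
  (forall x : R, is_derive x (1 : R) f (f' x)) -> continuous f.
Proof. by move=> df x; apply/differentiable_continuous/derivable1_diffP. Qed.

Lemma is_derive_cstD (k : R) f (x df : R) :
  is_derive x (1 : R) f df -> is_derive x (1 : R) (fun y => k + f y) df.
Proof.
move=> h; rewrite -[X in is_derive _ _ _ X]add0r.
by apply: is_deriveD; exact: is_derive_cst.
Qed.

Lemma derive_ge0_homo f (f' : R -> R) :
  (forall x : R, is_derive x (1 : R) f (f' x)) -> (forall x, 0 <= f' x) ->
  {homo f : x y / x <= y}.
Proof.
move=> df f0 x y; rewrite le_eqVlt => /predU1P[->//|xy].
have [|c _ e] := MVT xy (fun z _ => df z).
  exact/continuous_subspaceT/is_derive_continuous.
by rewrite -subr_ge0 e mulr_ge0// subr_ge0 ltW.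
Qed.

(** The form of the mean value theorem used for all estimates: a bound on
    derivatives becomes a bound on increments, with no integral involved,
    because both h - f and h + f are nondecreasing. *)
Lemma derive_le_dist f h (f' h' : R -> R) :
  (forall x : R, is_derive x (1 : R) f (f' x)) ->
  (forall x : R, is_derive x (1 : R) h (h' x)) ->
  (forall x, `|f' x| <= h' x) ->
  forall x y, x <= y -> `|f y - f x| <= h y - h x.
Proof.
move=> df dh le x y xy.
have d1 z : is_derive z (1 : R) (h - f) (h' z - f' z).
  exact: is_deriveB.
have d2 z : is_derive z (1 : R) (h + f) (h' z + f' z).
  exact: is_deriveD.
have h1 := derive_ge0_homo _ _ d1 _ _ _ xy.
have h2 := derive_ge0_homo _ _ d2 _ _ _ xy.
have {}h1 : h x - f x <= h y - f y.
  by apply: h1 => z; have := le z; rewrite ler_norml; lra.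
have {}h2 : h x + f x <= h y + f y.
  by apply: h2 => z; have := le z; rewrite ler_norml; lra.
by rewrite ler_norml; lra.
Qed.

Lemma cvgNy_atan : (@atan R) x @[x --> -oo] --> - (pi / 2).
Proof.
apply/cvgNy_compNP => /=.
have -> : (fun x : R => atan (- x)) = (fun x => - atan x).
  by apply/funext => x; rewrite atanN.
by apply: cvgN; exact: cvgy_atan.
Qed.

End Comparison.

(** * Primitives of functions decaying like 1 / (1 + x ^ 2) *)

Section Primitives.
Context {R : realType}.
Local Notation mu := (@lebesgue_measure R).
Implicit Types f g h : R -> R.

Lemma derive_le_distNy f h (f' h' : R -> R) (l m : R) :
  (forall x : R, is_derive x (1 : R) f (f' x)) ->
  (forall x : R, is_derive x (1 : R) h (h' x)) ->
  (forall x, `|f' x| <= h' x) ->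
  f x @[x --> -oo] --> l -> h x @[x --> -oo] --> m ->
  forall y, `|f y - l| <= h y - m.
Proof.
move=> df dh le fl hm y.
have h1 : `|f y - f x| @[x --> -oo] --> `|f y - l|.
  by apply: cvg_norm; apply: cvgB fl; exact: cvg_cst.
have h2 : h y - h x @[x --> -oo] --> h y - m.
  by apply: cvgB hm; exact: cvg_cst.
apply: ler_cvg_to h1 h2 _; near=> x.
apply: derive_le_dist df dh le _ _ _.
by near: x; apply: nbhs_ninfty_le; exact: num_real.
Unshelve. all: by end_near. Qed.

(** The profile 1 / (1 + x ^ 2) is the derivative of atan, which makes every
    bound by it integrable explicitly. *)
Definition decays (c : R) f := forall x, `|f x| <= c * (1 + x ^+ 2)^-1.

Lemma integrable_lorentz :
  mu.-integrable [set: R] (EFin \o (fun x : R => (1 + x ^+ 2)^-1)).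
Proof.
have c1 : continuous (fun x : R => (1 + x ^+ 2)^-1).
  exact: (@continuous_oneDsqrV R).
have g0 (x : R) : 0 <= (1 + x ^+ 2)^-1.
  by rewrite invr_ge0 addr_ge0// sqr_ge0.
apply/integrableP; split.
  by apply/measurable_EFinP; exact: continuous_measurable_fun.
under eq_integral => x _ do rewrite /= ger0_norm//.
rewrite ge0_symfun_integralT//; last by move=> x /=; rewrite sqrrN.
rewrite -set_itvcy; have := @integral0y_oneDsqr R; rewrite /oneDsqr => ->.
by rewrite -EFinM ltry.
Qed.

Lemma decays_integrable c f : continuous f -> decays c f ->
  mu.-integrable [set: R] (EFin \o f).
Proof.
move=> cf df.
apply: (@le_integrable _ _ _ mu setT measurableT _
          (EFin \o (fun x => c * (1 + x ^+ 2)^-1))).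
- by apply/measurable_EFinP; exact: continuous_measurable_fun.
- move=> x _ /=; rewrite lee_fin; apply: le_trans (df x) _.
  exact: ler_norm.
- have := integrableZl measurableT c integrable_lorentz.
  by apply: eq_integrable => // x _ /=.
Qed.

Definition primitive f (x : R) : R := \int[mu]_(t in `]-oo, x]) f t.

Lemma is_derive_primitive f : mu.-integrable [set: R] (EFin \o f) ->
  continuous f -> forall x : R, is_derive x (1 : R) (primitive f) (f x).
Proof.
move=> fi cf x.
have [] := @continuous_FTC1 R f -oo%O x (x + 1) _ _ _ (cf x).
- by rewrite ltrDl.
- by apply: integrableS fi.
- by rewrite ltNyr.
move=> d1 d2; apply: DeriveDef => //.
by rewrite -derive1E d2.
Qed.

(** Dominated convergence for the truncations of f to the half-lines ending
    at u n; D is the whole line or the empty set in its two uses. *)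
Lemma primitive_seq f (u : R^nat) (D : set R) : measurable D ->
  mu.-integrable [set: R] (EFin \o f) ->
  (forall x, \forall n \near \oo, (`]-oo, u n]%classic x <-> D x)) ->
  primitive f (u n) @[n --> \oo] --> \int[mu]_(x in D) f x.
Proof.
move=> mD fi uD.
suff: fine (\int[mu]_x (EFin \o (f \_ `]-oo, u n])) x)%E @[n --> \oo] -->
      fine (\int[mu]_x (EFin \o (f \_ D)) x)%E.
  set a := fun n => fine _; set b := fine _.
  have -> : a = fun n => primitive f (u n).
    by apply/funext => n; rewrite /primitive Rintegral_mkcond.
  have -> // : b = \int[mu]_(x in D) f x.
  by rewrite Rintegral_mkcond.
have iD (A : set R) : measurable A ->
    mu.-integrable [set: R] (EFin \o (f \_ A)).
  move=> mA; rewrite -restrict_EFin.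

  have H := (@integrable_mkcond _ _ _ mu A (EFin \o f) mA).1.
  apply: H.
  by apply: integrableS fi.
apply: fine_cvg; rewrite fineK; last exact: integrable_fin_num (iD _ mD).
have [|||||_ _] := @dominated_convergence _ _ _ mu setT measurableT
  (fun n => EFin \o (f \_ `]-oo, u n])) (EFin \o (f \_ D))
  (abse \o (EFin \o f)); last exact.
- by move=> n; case/integrableP: (iD `]-oo, u n]%classic (measurable_itv _)).
- by case/integrableP: (iD _ mD).
- apply: aeW => x _ /=; apply: cvg_near_cst.
  have := uD x; apply: filterS => n h; congr EFin; rewrite !patchE.
  case: ifPn => [/set_mem/h/mem_set ->//|]; case: ifPn => // /set_mem/h/mem_set.
  by move=> ->.
- exact: integrable_abse.
- apply: aeW => x n _ /=; rewrite lee_fin patchE.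
  by case: ifPn => // _; rewrite normr0.
Qed.

(** Limits of functions of a real variable are tested on sequences, to which
    dominated convergence applies. *)
Lemma primitive_cvgy f : mu.-integrable [set: R] (EFin \o f) ->
  primitive f x @[x --> +oo] --> \int[mu]_x f x.
Proof.
move=> fi; apply/cvg_pinftyP => u uy; apply: primitive_seq => // x.
near=> n; split => // _; rewrite /= in_itv/=.
by near: n; move/cvgryPge : uy; exact.
Unshelve. all: by end_near. Qed.

Lemma primitive_cvgNy f : mu.-integrable [set: R] (EFin \o f) ->
  primitive f x @[x --> -oo] --> 0.
Proof.
move=> fi; apply/cvg_ninftyP => u uy.
rewrite -(@Rintegral_set0 _ _ _ mu f); apply: primitive_seq => // x.
near=> n; split => //; rewrite /= in_itv/=; apply/negP; rewrite -ltNge.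
by near: n; move/cvgrNyPlt : uy; exact.
Unshelve. all: by end_near. Qed.

(** Compare with c * atan, whose total increase is c * pi. *)
Lemma primitive_bound c f : continuous f -> decays c f ->
  forall x, `|primitive f x| <= c * pi.
Proof.
move=> cf df x; have fi := decays_integrable _ _ cf df.
have dh (y : R) : is_derive y (1 : R) (fun y => c * atan y)
    (c * (1 + y ^+ 2)^-1).
  exact: is_deriveZ.
have := @derive_le_distNy _ _ _ _ 0 (c * - (pi / 2)) (is_derive_primitive _ fi cf) dh df
   (primitive_cvgNy _ fi) _ x.
rewrite subr0 => h; apply: le_trans (h _) _.
  by apply: cvgMr; exact: cvgNy_atan.
rewrite -mulrBr opprK; apply: ler_wpM2l.
  by have := df 0; rewrite expr0n addr0 invr1 mulr1; apply: le_trans.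
by have := atan_ltpi2 x; lra.
Qed.

End Primitives.

(** * Linear systems with integrable coefficients on the line *)

Section LinearSystem.
Context {R : realType}.
Implicit Types (c K : R).

(** The sequences u n - K / 2 ^ n and u n + K / 2 ^ n are monotone and
    enclose each other, so the supremum of the first is the limit, with an
    explicit rate. *)
Lemma geometric_limit (u : nat -> R) K :
  (forall n, `|u n.+1 - u n| <= K * 2^-1 ^+ n.+1) ->
  exists l, forall n, `|l - u n| <= K * 2^-1 ^+ n.
Proof.
move=> du.
pose lo n := u n - K * 2^-1 ^+ n; pose hi n := u n + K * 2^-1 ^+ n.
have stepl n : lo n <= lo n.+1.
  have := du n; rewrite /lo ler_norml exprS; move: (2^-1 ^+ n) => t.
  by move=> /andP[]; lra.
have steph n : hi n.+1 <= hi n.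
  have := du n; rewrite /hi ler_norml exprS; move: (2^-1 ^+ n) => t.
  by move=> /andP[]; lra.
have K0 : 0 <= K by have := le_trans (normr_ge0 _) (du 0%N); lra.
have lohi n : lo n <= hi n.
  have : 0 <= K * 2^-1 ^+ n by rewrite mulr_ge0// exprn_ge0.
  by rewrite /lo /hi; lra.
have monl : {homo lo : m n / (m <= n)%N >-> m <= n}.
  exact: (homo_leq (@lexx _ _) (@le_trans _ _)).
have monh : {homo hi : m n / (m <= n)%N >-> n <= m}.
  by apply: (@homo_leq _ hi (fun x y => y <= x)) => // x y z /[swap]; apply: le_trans.
have cross m n : lo m <= hi n.
  apply: le_trans (monl _ _ (leq_maxl m n)) _.
  exact: le_trans (lohi _) (monh _ _ (leq_maxr m n)).
have sl : has_sup (range lo).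
  by split; [exists (lo 0%N), 0%N | exists (hi 0%N) => _ [m _ <-]].
exists (sup (range lo)) => n; rewrite ler_norml.
have h1 : lo n <= sup (range lo) by apply: ub_le_sup => //; exact: sl.2.
have h2 : sup (range lo) <= hi n.
  by apply: ge_sup; [exact: sl.1 | move=> _ [m _ <-]].
by move: h1 h2; rewrite /lo /hi; lra.
Qed.

Lemma half_power_le (e : R) K : 0 < e -> exists n, K * 2^-1 ^+ n < e.
Proof.
move=> e0.
have h : K * 2^-1 ^+ n @[n --> \oo] --> K * 0.
  by apply: cvgMr; apply: cvg_expr; rewrite ger0_norm//; lra.
rewrite mulr0 in h; have [N _ /(_ N (leqnn _)) hN] := (cvgr_lt _ h) _ e0.
by exists N.
Qed.

Lemma eq_of_half_powers (x y : R) K :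
  (forall n, `|x - y| <= K * 2^-1 ^+ n) -> x = y.
Proof.
move=> h; apply/eqP; rewrite -subr_eq0 -normr_le0 leNgt; apply/negP => xy.
by have [n] := half_power_le _ K xy; rewrite ltNge h.
Qed.

Variables (P : bool -> bool -> R -> R) (c : R).
Hypothesis cP : forall i j, continuous (P i j).
Hypothesis dP : forall i j, decays c (P i j).

(** The booleans index the two components: true is the first one, false the
    second. *)
Definition apply_system (Y : bool -> R -> R) (i : bool) (x : R) : R :=
  P i true x * Y true x + P i false x * Y false x.

Let c0 : 0 <= c.
Proof.
have := le_trans (normr_ge0 _) (dP true true 0).
by rewrite expr0n addr0 invr1 mulr1.
Qed.

Lemma apply_system_continuous Y : (forall i, continuous (Y i)) ->
  forall i, continuous (apply_system Y i).
Proof.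
move=> cY i x; apply: cvgD; apply: cvgM; [exact: cP|exact: cY|exact: cP|exact: cY].
Qed.

Lemma apply_system_le Y (b : R) x : (forall i, `|Y i x| <= b) ->
  forall i, `|apply_system Y i x| <= 2 * c * (1 + x ^+ 2)^-1 * b.
Proof.
move=> Yb i; apply: le_trans (ler_normD _ _) _; rewrite !normrM.
have h j : `|P i j x| * `|Y j x| <= c * (1 + x ^+ 2)^-1 * b.
  by apply: ler_pM => //; exact: dP.
by have := h true; have := h false; lra.
Qed.

(** A weight in the style of Bielecki: its logarithmic derivative is twice
    the total size 2 c / (1 + x ^ 2) of the coefficients, so in the norm it
    defines the Picard map contracts by 1 / 2 on the whole line. *)
Definition weight (x : R) : R := expR (4 * c * (atan x + pi / 2)).

Lemma is_derive_weight (x : R) :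
  is_derive x (1 : R) weight (4 * c * (1 + x ^+ 2)^-1 * weight x).
Proof.
have d1 : is_derive x (1 : R) (fun x => 4 * c * (atan x + pi / 2))
    (4 * c * ((1 + x ^+ 2)^-1 + 0)).
  by apply: is_deriveZ; apply: is_deriveD.
apply: (@is_derive_eq _ _ _ _ _ _ _ _
  (@is_derive1_comp _ expR _ x _ _ (is_derive_expR _) d1)).
by rewrite addr0 mulrC.
Qed.

Lemma weight_ge1 x : 1 <= weight x.
Proof.
rewrite /weight -{1}expR0 ler_expR; apply: mulr_ge0; first exact: mulr_ge0.
by have := atan_gtNpi2 x; lra.
Qed.

Lemma weight_le x : weight x <= expR (4 * c * pi).
Proof.
rewrite /weight ler_expR; apply: ler_wpM2l; first exact: mulr_ge0.
by have := atan_ltpi2 x; lra.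
Qed.

Lemma weight_cvgNy : weight x @[x --> -oo] --> (1 : R).
Proof.
have h : 4 * c * (atan x + pi / 2) @[x --> -oo] --> (0 : R).
  rewrite -[X in _ --> X](mulr0 (4 * c)); apply: cvgMr.
  rewrite -[X in _ --> X](addNr (pi / 2)); apply: cvgD; last exact: cvg_cst.
  exact: cvgNy_atan.
by rewrite -[X in _ --> X]expR0; exact: (cvg_comp _ _ h (@continuous_expR R 0)).
Qed.

(** The derivative of F i is bounded by 2 c / (1 + x ^ 2) * b * weight x,
    which is the derivative of b / 2 * weight. *)
Lemma picard_contraction (Y : bool -> R -> R) (F : bool -> R -> R) (b : R) :
  (forall i x, `|Y i x| <= b * weight x) ->
  (forall i (x : R), is_derive x (1 : R) (F i) (apply_system Y i x)) ->
  (forall i, F i x @[x --> -oo] --> 0) ->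
  forall i x, `|F i x| <= b / 2 * weight x.
Proof.
move=> Yb dF F0 i x.
have b0 : 0 <= b.
  have := le_trans (normr_ge0 _) (Yb true 0).
  by rewrite pmulr_lge0// (lt_le_trans ltr01 (weight_ge1 0)).
have dh (y : R) : is_derive y (1 : R) (fun y => b / 2 * weight y)
    (b / 2 * (4 * c * (1 + y ^+ 2)^-1 * weight y)).
  by have := is_derive_weight y => ?; exact: is_deriveZ.
have := @derive_le_distNy R (F i) _ _ _ 0 (b / 2 * 1) (dF i) dh _ (F0 i) _ x.
rewrite subr0 => h; apply: le_trans (h _ _) _.
- move=> y; apply: le_trans (apply_system_le _ _ _ (Yb ^~ y) i) _.
  by move: (1 + y ^+ 2)^-1 (weight y) => t z; rewrite le_eqVlt; apply/orP; left;
    apply/eqP; field.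
- by apply: cvgMr; exact: weight_cvgNy.
- by rewrite lerBlDr lerDl; lra.
Qed.

Variables (a : bool -> R) (A : R).
Hypothesis aA : forall i, `|a i| <= A.

Fixpoint picard (n : nat) (i : bool) (x : R) : R :=
  if n is m.+1 then a i + primitive (apply_system (picard m) i) x else a i.

Lemma apply_system_integrable Y b : (forall i, continuous (Y i)) ->
  (forall i x, `|Y i x| <= b) ->
  (forall i, decays (2 * c * b) (apply_system Y i)) /\
  (forall i, lebesgue_measure.-integrable [set: R] (EFin \o apply_system Y i)).
Proof.
move=> cY Yb.
have d i : decays (2 * c * b) (apply_system Y i).
  move=> x; apply: le_trans (apply_system_le _ _ _ (Yb ^~ x) i) _.
  by rewrite mulrAC.
split=> // i; apply: decays_integrable (d i); exact: apply_system_continuous.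
Qed.

Lemma picard_regular n : (forall i, continuous (picard n i)) /\
  (exists b, forall i x, `|picard n i x| <= b).
Proof.
elim: n => [|n [cn [b bn]]].
  by split=> [i|]; [exact: cst_continuous | exists A => i x; exact: aA].
have [d it] := apply_system_integrable _ _ cn bn.
split=> [i x|].
  apply: cvgD; first exact: cvg_cst.
  apply: is_derive_continuous; apply: is_derive_primitive => //.
  exact: apply_system_continuous.
exists (A + 2 * c * b * pi) => i x; apply: le_trans (ler_normD _ _) _.
apply: lerD => //; apply: primitive_bound => //.
exact: apply_system_continuous.
Qed.

Lemma picard_primitive n i :
  (forall x : R, is_derive x (1 : R) (picard n.+1 i) (apply_system (picard n) i x)) /\
  picard n.+1 i x @[x --> -oo] --> a i.
Proof.
have [cn [b bn]] := picard_regular n.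
have [d it] := apply_system_integrable _ _ cn bn.
split=> [x|].
  apply: is_derive_cstD.
  by apply: is_derive_primitive => //; exact: apply_system_continuous.
rewrite -[X in _ --> X]addr0; apply: cvgD; first exact: cvg_cst.
exact: primitive_cvgNy.
Qed.

Lemma picard_step n i x :
  `|picard n.+1 i x - picard n i x| <= A * 2^-1 ^+ n.+1 * weight x.
Proof.
elim: n i x => [|n IH] i x.
  rewrite expr1; apply: (picard_contraction (fun i _ => a i)
    (fun i x => picard 1 i x - picard 0 i x) A) => [j y|j y|j].
  - apply: le_trans (aA j) _; rewrite ler_peMr//; last exact: weight_ge1.
    exact: le_trans (normr_ge0 _) (aA true).
  - rewrite -[X in is_derive _ _ _ X]subr0; apply: is_deriveB.
      exact: (picard_primitive 0 j).1.
    exact: is_derive_cst.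
  - rewrite -[X in _ --> X](subrr (a j)); apply: cvgB; last exact: cvg_cst.
    exact: (picard_primitive 0 j).2.
rewrite exprSr mulrA; apply: (picard_contraction
  (fun i x => picard n.+1 i x - picard n i x)
  (fun i x => picard n.+2 i x - picard n.+1 i x)) => // [j y|j].
- rewrite (_ : apply_system _ _ _ = apply_system (picard n.+1) j y -
    apply_system (picard n) j y); last by rewrite /apply_system; ring.
  by apply: is_deriveB; exact: (picard_primitive _ _).1.
- rewrite -[X in _ --> X](subrr (a j)).
  by apply: cvgB; exact: (picard_primitive _ _).2.
Qed.

(** The Picard iterates converge geometrically and uniformly on the line,
    and the limit satisfies the integral equation; both limits at infinity
    and the bound, which depends on the coefficients only through c, are
    read off from it. *)
Lemma linear_system_exists : exists Y : bool -> R -> R,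
  [/\ forall i (x : R), is_derive x (1 : R) (Y i) (apply_system Y i x),
      forall i, Y i x @[x --> -oo] --> a i,
      forall i, exists l : R, Y i x @[x --> +oo] --> l &
      forall i x, `|Y i x| <= A * (1 + expR (4 * c * pi))].
Proof.
pose K := A * expR (4 * c * pi).
have A0 : 0 <= A by exact: le_trans (normr_ge0 _) (aA true).
have step i x n : `|picard n.+1 i x - picard n i x| <= K * 2^-1 ^+ n.+1.
  apply: le_trans (picard_step n i x) _; rewrite /K mulrAC.
  apply: ler_wpM2r; first by rewrite exprn_ge0.
  by apply: ler_wpM2l => //; exact: weight_le.
have [Y0 Y0P] := choice (fun ix : bool * R =>
  geometric_limit (fun n => picard n ix.1 ix.2) K (step ix.1 ix.2)).
pose Y i x := Y0 (i, x).
have YP i x n : `|Y i x - picard n i x| <= K * 2^-1 ^+ n.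
  exact: (Y0P (i, x) n).
have K0 : 0 <= K by rewrite mulr_ge0// expR_ge0.
have Yb i x : `|Y i x| <= A * (1 + expR (4 * c * pi)).
  have := YP i x 0%N; rewrite expr0 mulr1 /= => h.
  rewrite mulrDr mulr1 -/K -[Y i x](subrK (a i)) addrC.
  by apply: le_trans (ler_normD _ _) _; exact: lerD.
have cY i : continuous (Y i).
  move=> x; apply/cvgrPdist_lt => e e0.
  have [n hn] := half_power_le (e / 3) K ltac:(by lra).
  near=> y.
  have h1 := YP i x n; have h2 := YP i y n.
  have h3 : `|picard n i x - picard n i y| < e / 3.
    near: y; have := (picard_regular n).1 i x.
    by move/cvgrPdist_lt; apply; lra.
  rewrite (_ : Y i x - Y i y = (Y i x - picard n i x) -
    (Y i y - picard n i y) + (picard n i x - picard n i y)); last by ring.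
  apply: le_lt_trans (ler_normD _ _) _.
  by have := ler_normB (Y i x - picard n i x) (Y i y - picard n i y); lra.
have [dY iY] := apply_system_integrable _ _ cY Yb.
have eqY i x : Y i x = a i + primitive (apply_system Y i) x.
  apply: (@eq_of_half_powers _ _ (K * (1 + 2 * c * pi))) => n.
  have h1 : `|Y i x - picard n.+1 i x| <= K * 2^-1 ^+ n.
    apply: le_trans (YP i x _) _; apply: ler_wpM2l => //.
    by rewrite exprS ler_piMl// ?exprn_ge0//; lra.
  have cD j : continuous (fun y => picard n j y - Y j y).
    by move=> y; apply: cvgB; [exact: (picard_regular n).1 | exact: cY].
  have [] := apply_system_integrable (fun j y => picard n j y - Y j y)
    (K * 2^-1 ^+ n) cD _.
    by move=> j y; rewrite distrC.
  move=> /(_ i) dD _.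
  have dh (y : R) : is_derive y (1 : R) (fun y => 2 * c * (K * 2^-1 ^+ n) * atan y)
      (2 * c * (K * 2^-1 ^+ n) * (1 + y ^+ 2)^-1).
    exact: is_deriveZ.
  have dF (y : R) : is_derive y (1 : R)
      (fun y => picard n.+1 i y - (a i + primitive (apply_system Y i) y))
      (apply_system (fun j y => picard n j y - Y j y) i y).
    rewrite (_ : apply_system _ _ _ = apply_system (picard n) i y -
      apply_system Y i y); last by rewrite /apply_system; ring.
    apply: is_deriveB; first exact: (picard_primitive _ _).1.
    apply: is_derive_cstD.
    by apply: is_derive_primitive => //; exact: apply_system_continuous.
  have := @derive_le_distNy R _ _ _ _ 0 (2 * c * (K * 2^-1 ^+ n) * - (pi / 2))
    dF dh dD _ _ x.
  rewrite subr0 => h2.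
  rewrite -[Y i x](subrK (picard n.+1 i x)) -addrA.
  apply: le_trans (ler_normD _ _) _.
  rewrite mulrAC mulrDr mulr1; apply: lerD => //.
  apply: le_trans (h2 _ _) _.
  - rewrite -[X in _ --> X](subrr (a i)); apply: cvgB; first exact: (picard_primitive _ _).2.
    rewrite -[X in _ --> X]addr0; apply: cvgD; first exact: cvg_cst.
    exact: primitive_cvgNy.
  - by apply: cvgMr; exact: cvgNy_atan.
  - have -> : K * 2^-1 ^+ n * (2 * c * pi) = 2 * c * (K * 2^-1 ^+ n) * pi.
      by ring.
    rewrite -mulrBr opprK; apply: ler_wpM2l.
      by rewrite !mulr_ge0// exprn_ge0.
    by have := atan_ltpi2 x; lra.
have eqY' i : Y i = fun x => a i + primitive (apply_system Y i) x.
  by apply/funext => x.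
exists Y; split=> // [i x|i|i].
- rewrite {1}eqY'; apply: is_derive_cstD.
  by apply: is_derive_primitive => //; exact: apply_system_continuous.
- rewrite eqY' -[X in _ --> X]addr0; apply: cvgD; first exact: cvg_cst.
  exact: primitive_cvgNy.
- rewrite eqY'; exists (a i + \int[lebesgue_measure]_x apply_system Y i x).
  apply: cvgD; first exact: cvg_cst.
  exact: primitive_cvgy.
Unshelve. all: by end_near. Qed.

End LinearSystem.

(** * The first-order system behind the factorized operator *)

Section ScatteringSystem.
Context {R : realType}.
Implicit Types (w S f g y z : R -> R) (k c : R).

Lemma sin_le_norm (t : R) : `|sin t| <= `|t|.
Proof.
wlog t0 : t / 0 <= t => [H|].
  have [/H//|/ltW t0] := leP 0 t.
  by rewrite -normrN -sinN -(normrN t); apply: H; rewrite oppr_ge0.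
have := @derive_le_dist R sin id cos (cst 1) (@is_derive_sin R)
  (fun x => is_derive_id x 1) _ 0 t t0.
by rewrite sin0 !subr0 (ger0_norm t0); apply => x; exact: cos_max.
Qed.

Lemma one_sub_cos_le_norm (t : R) : `|1 - cos t| <= `|t|.
Proof.
wlog t0 : t / 0 <= t => [H|].
  have [/H//|/ltW t0] := leP 0 t.
  by rewrite -cosN -(normrN t); apply: H; rewrite oppr_ge0.
have := @derive_le_dist R cos id _ (cst 1) (@is_derive_cos R)
  (fun x => is_derive_id x 1) _ 0 t t0.
rewrite cos0 !subr0 (ger0_norm t0) distrC; apply => x.
by rewrite normrN; exact: sin_max.
Qed.

(** The system u' = - w u + k v, v' = w v - k u seen in the frame rotating
    with frequency k: the terms in k disappear and w multiplies a reflection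
    matrix of angle 2 k x. *)
Definition rotating_matrix w k (i j : bool) (x : R) : R :=
  match i, j with
  | true, true => - (w x * cos (2 * k * x))
  | false, false => w x * cos (2 * k * x)
  | _, _ => - (w x * sin (2 * k * x))
  end.

Lemma is_derive_scale k (x : R) : is_derive x (1 : R) (fun x => k * x) k.
Proof.
rewrite -[X in is_derive _ _ _ X]mulr1.
exact: (is_deriveZ k (is_derive_id x 1)).
Qed.

Lemma is_derive_cos_scale k (x : R) :
  is_derive x (1 : R) (fun x => cos (k * x)) (- (k * sin (k * x))).
Proof.
apply: (@is_derive_eq _ _ _ _ _ _ _ _ (@is_derive1_comp _ cos _ x _ _
  (is_derive_cos _) (is_derive_scale k x))).
by rewrite mulNr mulrC.
Qed.

Lemma is_derive_sin_scale k (x : R) :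
  is_derive x (1 : R) (fun x => sin (k * x)) (k * cos (k * x)).
Proof.
apply: (@is_derive_eq _ _ _ _ _ _ _ _ (@is_derive1_comp _ sin _ x _ _
  (is_derive_sin _) (is_derive_scale k x))).
by rewrite mulrC.
Qed.

Lemma rotating_matrix_regular w k c : continuous w -> decays c w ->
  (forall i j, continuous (rotating_matrix w k i j)) /\
  (forall i j, decays c (rotating_matrix w k i j)).
Proof.
move=> cw dw.
have ccos : continuous (fun x => cos (2 * k * x)).
  exact: is_derive_continuous (is_derive_cos_scale (2 * k)).
have csin : continuous (fun x => sin (2 * k * x)).
  exact: is_derive_continuous (is_derive_sin_scale (2 * k)).
have dm (t : R) x : `|t| <= 1 -> `|w x * t| <= c * (1 + x ^+ 2)^-1.
  by move=> t1; rewrite normrM; apply: le_trans (dw x); rewrite ler_piMr.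
split=> -[] [] x /=.
- by apply: cvgN; apply: cvgM; [exact: cw | exact: ccos].
- by apply: cvgN; apply: cvgM; [exact: cw | exact: csin].
- by apply: cvgN; apply: cvgM; [exact: cw | exact: csin].
- by apply: cvgM; [exact: cw | exact: ccos].
- by rewrite normrN; apply: dm; exact: cos_max.
- by rewrite normrN; apply: dm; exact: sin_max.
- by rewrite normrN; apply: dm; exact: sin_max.
- by apply: dm; exact: cos_max.
Qed.

(** The component u of the unrotated pair; [corotate] is the component v. *)
Definition rotate k (Y : bool -> R -> R) (x : R) : R :=
  Y true x * cos (k * x) + Y false x * sin (k * x).

Definition corotate k (Y : bool -> R -> R) (x : R) : R :=
  Y false x * cos (k * x) - Y true x * sin (k * x).

Lemma double_angle k (x : R) :
  cos (2 * k * x) = cos (k * x) ^+ 2 - sin (k * x) ^+ 2 /\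
  sin (2 * k * x) = 2 * (sin (k * x) * cos (k * x)).
Proof.
have -> : 2 * k * x = k * x + k * x by ring.
by rewrite cosD sinD; split; ring.
Qed.

(** Undoing the rotation turns the rotating system into u' = - w u + k v, v'
    = w v - k u. *)
Lemma is_derive_rotate w k Y :
  (forall i (x : R), is_derive x (1 : R) (Y i)
    (apply_system (rotating_matrix w k) Y i x)) ->
  (forall x : R, is_derive x (1 : R) (rotate k Y)
    (- (w x * rotate k Y x) + k * corotate k Y x)) /\
  (forall x : R, is_derive x (1 : R) (corotate k Y)
    (w x * corotate k Y x - k * rotate k Y x)).
Proof.
move=> dY.
have dc x := is_derive_cos_scale k x.
have ds x := is_derive_sin_scale k x.
split=> x.
  apply: (@is_derive_eq _ _ _ _ _ _ _ _
    (is_deriveD (is_deriveM (dY true x) (dc x)) (is_deriveM (dY false x) (ds x)))).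
  have [e1 e2] := double_angle k x; have e3 := cos2Dsin2 (k * x).
  rewrite /apply_system /rotate /corotate /GRing.scale /= e1 e2.
  move: (w x) (Y true x) (Y false x) (cos _) (sin _) e3 => w0 a b C s e3.
  transitivity (- (w0 * ((C ^+ 2 + s ^+ 2) * (a * C + b * s))) +
    k * (b * C - a * s)); last by rewrite e3; ring.
  by ring.
apply: (@is_derive_eq _ _ _ _ _ _ _ _
  (is_deriveB (is_deriveM (dY false x) (dc x)) (is_deriveM (dY true x) (ds x)))).
have [e1 e2] := double_angle k x; have e3 := cos2Dsin2 (k * x).
rewrite /apply_system /rotate /corotate /GRing.scale /= e1 e2.
move: (w x) (Y true x) (Y false x) (cos _) (sin _) e3 => w0 a b C s e3.
transitivity (w0 * ((C ^+ 2 + s ^+ 2) * (b * C - a * s)) -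
  k * (a * C + b * s)); last by rewrite e3; ring.
by ring.
Qed.

(** The derivative y' is kept as a parameter, so that wronskians can be
    written without choosing derivatives. *)
Definition solution (V y y' : R -> R) : Prop :=
  (forall x : R, is_derive x (1 : R) y (y' x)) /\
  (forall x : R, is_derive x (1 : R) y' (- (V x * y x))).

(** Eliminating v: u'' = - w' u - w u' + k v' = (w ^ 2 - w') u - k ^ 2 u. *)
Lemma rotate_solution w (w' : R -> R) k Y :
  (forall x : R, is_derive x (1 : R) w (w' x)) ->
  (forall i (x : R), is_derive x (1 : R) (Y i)
    (apply_system (rotating_matrix w k) Y i x)) ->
  solution (fun x => w' x - w x ^+ 2 + k ^+ 2) (rotate k Y)
    (fun x => - (w x * rotate k Y x) + k * corotate k Y x).
Proof.
move=> dw /is_derive_rotate [du dv]; split=> // x.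
apply: (@is_derive_eq _ _ _ _ _ _ _ _
  (is_deriveD (is_deriveN (is_deriveM (dw x) (du x))) (is_deriveZ k (dv x)))).
by rewrite /GRing.scale /=; ring.
Qed.

Lemma wronskian_cst V y y' z z' : solution V y y' -> solution V z z' ->
  exists C, forall x, y x * z' x - y' x * z x = C.
Proof.
move=> [dy dy'] [dz dz']; exists (y 0 * z' 0 - y' 0 * z 0) => x.
apply: (@is_derive_0_is_cst R (fun x => y x * z' x - y' x * z x)) => {}x.
apply: (@is_derive_eq _ _ _ _ _ _ _ _
  (is_deriveB (is_deriveM (dy x) (dz' x)) (is_deriveM (dy' x) (dz x)))).
by rewrite /GRing.scale /=; ring.
Qed.

(** Cramer's rule: the coefficients of y on u and v are quotients of
    wronskians, hence constants. *)
Lemma solution_span V u u' v v' (C : R) : solution V u u' -> solution V v v' ->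
  (forall x, u x * v' x - u' x * v x = C) -> C != 0 ->
  forall y y', solution V y y' ->
  exists c d, forall x, y x = c * u x + d * v x.
Proof.
move=> su sv W C0 y y' sy.
have [D1 h1] := wronskian_cst _ _ _ _ _ sy sv.
have [D2 h2] := wronskian_cst _ _ _ _ _ su sy.
exists (D1 / C), (D2 / C) => x.
apply: (mulfI C0); transitivity (D1 * u x + D2 * v x); last by field.
by rewrite -(h1 x) -(h2 x) -(W x); ring.
Qed.

(** At k = 0 the function f * exp S would be constant. For k != 0 its
    derivative is w * exp S * (f * (1 - cos (2 k x)) - g * sin (2 k x)),
    which is at most a constant times |k| |x w x|, so f * exp S moves by
    O(|k|) in total. The statement covers both components of the rotating
    system: the exchange of f and g together with w -> - w, S -> - S, k -> -
    k preserves it. *)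
Lemma small_frequency_limit w S f g k c B sigma a l I :
  (forall x : R, is_derive x (1 : R) S (w x)) ->
  (forall x, `|S x| <= sigma) ->
  decays c (fun x => x * w x) ->
  (forall x, `|f x| <= B) -> (forall x, `|g x| <= B) ->
  (forall x : R, is_derive x (1 : R) f
    (- (w x * (f x * cos (2 * k * x) + g x * sin (2 * k * x))))) ->
  S x @[x --> -oo] --> (0 : R) -> S x @[x --> +oo] --> (I : R) ->
  f x @[x --> -oo] --> (a : R) -> f x @[x --> +oo] --> (l : R) ->
  `|l * expR I - a| <= 4 * B * expR sigma * c * pi * `|k|.
Proof.
move=> dS Sb dw fB gB df S0 SI fa fl.
have B0 : 0 <= B by exact: le_trans (normr_ge0 _) (fB 0).
have dE (x : R) : is_derive x (1 : R) (fun x => expR (S x)) (w x * expR (S x)).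
  apply: (@is_derive_eq _ _ _ _ _ _ _ _
    (@is_derive1_comp _ expR _ x _ _ (is_derive_expR _) (dS x))).
  by rewrite mulrC.
pose F x := f x * expR (S x).
have dF (x : R) : is_derive x (1 : R) F (w x * expR (S x) *
    (f x * (1 - cos (2 * k * x)) - g x * sin (2 * k * x))).
  apply: (@is_derive_eq _ _ _ _ _ _ _ _ (is_deriveM (df x) (dE x))).
  by rewrite /GRing.scale /=; ring.
(* The factor 4: both 1 - cos (2 k x) and sin (2 k x) are at most 2 |k| |x|. *)
pose M := 4 * B * expR sigma * c * `|k|.
have dh (x : R) : is_derive x (1 : R) (fun x => M * atan x)
    (M * (1 + x ^+ 2)^-1).
  exact: is_deriveZ.
have le x : `|w x * expR (S x) *
    (f x * (1 - cos (2 * k * x)) - g x * sin (2 * k * x))| <=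
    M * (1 + x ^+ 2)^-1.
  have h1 : `|f x * (1 - cos (2 * k * x)) - g x * sin (2 * k * x)| <=
      4 * B * `|k| * `|x|.
    apply: le_trans (ler_normB _ _) _; rewrite !normrM.
    have hc := one_sub_cos_le_norm (2 * k * x).
    have hs := sin_le_norm (2 * k * x).
    have h2 : `|f x| * `|1 - cos (2 * k * x)| <= B * `|2 * k * x|.
      exact: ler_pM.
    have h3 : `|g x| * `|sin (2 * k * x)| <= B * `|2 * k * x|.
      exact: ler_pM.
    move: h2 h3; rewrite [`|2 * k * x|]normrM [`|2 * k|]normrM.
    by rewrite (@ger0_norm _ 2)//; lra.
  have h2 : expR (S x) <= expR sigma.
    by rewrite ler_expR; apply: le_trans (Sb x); exact: ler_norm.
  rewrite 2!normrM (@ger0_norm _ (expR _)) ?expR_ge0//.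
  have := dw x; rewrite normrM => h3.
  apply: (@le_trans _ _ (`|w x| * expR sigma * (4 * B * `|k| * `|x|))).
    by apply: ler_pM => //; exact: ler_wpM2l.
  have -> : `|w x| * expR sigma * (4 * B * `|k| * `|x|) =
    4 * B * expR sigma * `|k| * (`|x| * `|w x|) by ring.
  have -> : M * (1 + x ^+ 2)^-1 =
    4 * B * expR sigma * `|k| * (c * (1 + x ^+ 2)^-1) by rewrite /M; ring.
  by apply: ler_wpM2l => //; rewrite !mulr_ge0// expR_ge0.
have cE (T : set_system R) (FT : Filter T) (s : R) : S x @[x --> T] --> s ->
    expR (S x) @[x --> T] --> expR s.
  by move=> h; exact: (cvg_comp _ _ h (@continuous_expR R s)).
have F0 : F x @[x --> -oo] --> a.
  by rewrite -[X in _ --> X]mulr1 -expR0; apply: cvgM => //; exact: cE.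
have FI : F x @[x --> +oo] --> l * expR I by apply: cvgM => //; exact: cE.
have dist := @derive_le_distNy R F _ _ _ a (M * - (pi / 2)) dF dh le F0 _.
have {}dist x : `|F x - a| <= M * pi.
  apply: le_trans (dist _ x) _; first by apply: cvgMr; exact: cvgNy_atan.
  rewrite -mulrBr opprK; apply: ler_wpM2l.
    have := le_trans (normr_ge0 _) (le 0).
    by rewrite expr0n addr0 invr1 mulr1.
  by have := atan_ltpi2 x; lra.
have -> : 4 * B * expR sigma * c * pi * `|k| = M * pi by rewrite /M; ring.
apply: (@cvgr_to_le _ +oo _ R (fun x => `|F x - a|)).
  by apply: cvg_norm; apply: cvgB => //; exact: cvg_cst.
by apply: nearW.
Qed.

End ScatteringSystem.

(** * The fundamental matrix and its small-frequency limit *)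

Section FundamentalMatrix.
Context {R : realType}.
Local Notation mu := (@lebesgue_measure R).
Variables (w w' : R -> R) (c : R).
Hypothesis dw : forall x : R, is_derive x (1 : R) w (w' x).
Hypothesis decay0 : decays c w.
Hypothesis decay1 : decays c (fun x => x * w x).

Local Notation I := (\int[mu]_x w x).

Let cw : continuous w. Proof. exact: is_derive_continuous dw. Qed.

Let wi : mu.-integrable [set: R] (EFin \o w).
Proof. exact: decays_integrable decay0. Qed.

(** The constant of [small_frequency_limit] for the uniform bound 1 + exp (4
    c pi) on the solutions and the bound c * pi on the primitive of w;
    independence of k is what matters. *)
Definition frequency_rate : R :=
  4 * (1 * (1 + expR (4 * c * pi))) * expR (c * pi) * c * pi.

(** The matrix of the rotating system has trace zero. *)
Lemma determinant_cst k (Y Z : bool -> R -> R) :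
  (forall i (x : R), is_derive x (1 : R) (Y i)
    (apply_system (rotating_matrix w k) Y i x)) ->
  (forall i (x : R), is_derive x (1 : R) (Z i)
    (apply_system (rotating_matrix w k) Z i x)) ->
  forall x t, Y true x * Z false x - Z true x * Y false x =
              Y true t * Z false t - Z true t * Y false t.
Proof.
move=> dY dZ x t.
apply: (@is_derive_0_is_cst R
  (fun x => Y true x * Z false x - Z true x * Y false x)) => {x t} x.
apply: (@is_derive_eq _ _ _ _ _ _ _ _
  (is_deriveB (is_deriveM (dY true x) (dZ false x))
              (is_deriveM (dZ true x) (dY false x)))).
by rewrite /apply_system /GRing.scale /=; ring.
Qed.

(** The matrix m carries the values at - oo to the limits at + oo, which is
    all that scattering needs; the last clause says that it differs from
    diag (exp (- I), exp I) by O(|k|). *)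
Lemma fundamental_matrix k : exists (m : bool -> bool -> R)
    (Y : bool -> bool -> R -> R),
  [/\ forall j i (x : R), is_derive x (1 : R) (Y j i)
        (apply_system (rotating_matrix w k) (Y j) i x),
      forall j i, Y j i x @[x --> -oo] --> ((i == j)%:R : R),
      forall j i, Y j i x @[x --> +oo] --> m i j,
      (forall x, Y true true x * Y false false x -
                 Y false true x * Y true false x = 1) /\
      m true true * m false false - m true false * m false true = 1 &
      forall j, `|m true j * expR I - (true == j)%:R| <= frequency_rate * `|k| /\
                `|m false j * expR (- I) - (false == j)%:R| <=
                  frequency_rate * `|k| ].
Proof.
have [cP dP] := rotating_matrix_regular w k c cw decay0.
have d1 (j i : bool) : `|(i == j)%:R| <= 1 :> R.
  by case: eqP => _; rewrite ?normr1 ?normr0 ?ler01.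
have sol j := @linear_system_exists R _ c cP dP _ 1 (d1 j).
have [Y HY] := choice sol.
have dY j : forall i (x : R), is_derive x (1 : R) (Y j i)
  (apply_system (rotating_matrix w k) (Y j) i x) by have [] := HY j.
have Y0 j : forall i, Y j i x @[x --> -oo] --> ((i == j)%:R : R).
  by have [] := HY j.
have [m Hm] := choice (fun ij : bool * bool =>
  let: And4 _ _ h _ := HY ij.2 in h ij.1).
pose M i j := m (i, j).
have YM j i : Y j i x @[x --> +oo] --> M i j by exact: Hm (i, j).
have Yb j : forall i x, `|Y j i x| <= 1 * (1 + expR (4 * c * pi)).
  by have [] := HY j.
have detc := determinant_cst k (Y true) (Y false) (dY true) (dY false).
have det1 x : Y true true x * Y false false x -
    Y false true x * Y true false x = 1.
  have h : Y true true x * Y false false x - Y false true x * Y true false x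
      @[x --> -oo] --> (1 * 1 - 0 * 0 : R).
    by apply: cvgB; apply: cvgM; [exact: (Y0 true true) | exact: (Y0 false false)
      | exact: (Y0 false true) | exact: (Y0 true false)].
  move: h; rewrite mulr1 mulr0 subr0; under eq_fun do rewrite (detc _ x).
  by move/(cvg_lim (@Rhausdorff R)) <-; rewrite lim_cst.
exists M, Y; split => //.
- split=> //.
  have h : Y true true x * Y false false x - Y false true x * Y true false x
      @[x --> +oo] --> M true true * M false false - M true false * M false true.
    by apply: cvgB; apply: cvgM.
  move: h; under eq_fun do rewrite det1.
  by move/(cvg_lim (@Rhausdorff R)) <-; rewrite lim_cst.
- have dS (x : R) : is_derive x (1 : R) (primitive w) (w x).
    exact: is_derive_primitive.
  have Sb x : `|primitive w x| <= c * pi by exact: primitive_bound.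
  have S0 : primitive w x @[x --> -oo] --> (0 : R) by exact: primitive_cvgNy.
  have SI : primitive w x @[x --> +oo] --> I by exact: primitive_cvgy.
  move=> j; split.
    apply: (@small_frequency_limit R w (primitive w) (Y j true) (Y j false)) => //.
    move=> x; apply: (@is_derive_eq _ _ _ _ _ _ _ _ (dY j true x)).
    by rewrite /apply_system /=; ring.
  (* The second component is the first one of the system for - w and - k. *)
  rewrite -(normrN k).
  apply: (@small_frequency_limit R (fun x => - w x) (fun x => - primitive w x)
    (Y j false) (Y j true)) => //.
  - by move=> x; rewrite normrN.
  - by move=> x; rewrite mulrN normrN.
  - move=> x; apply: (@is_derive_eq _ _ _ _ _ _ _ _ (dY j false x)).
    have -> : 2 * - k * x = - (2 * k * x) by ring.
    by rewrite /apply_system /= cosN sinN; ring.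
  - by rewrite -[X in _ --> X]oppr0; exact: cvgN.
  - exact: cvgN.
Qed.

End FundamentalMatrix.

(** * Trigonometric asymptotics at infinity *)

Section Asymptotics.
Context {R : realType}.
Variables (F : set_system R) (PF : ProperFilter F).
Hypothesis shiftF : forall s : R, x + s @[x --> F] --> F.
Implicit Types (k : R) (u v : R -> R).

(** Convergence of the difference to zero, not of u itself: the
    trigonometric profile has no limit. *)
Definition asymp k u (a b : R) : Prop :=
  u x - (a * cos (k * x) + b * sin (k * x)) @[x --> F] --> (0 : R).

(** Rotations by angles depending on x preserve convergence to zero, since
    their entries are bounded by 1. *)
Lemma cvg0_bounded_mul (g u : R -> R) : (forall x, `|g x| <= 1) ->
  u x @[x --> F] --> (0 : R) -> g x * u x @[x --> F] --> (0 : R).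
Proof.
move=> g1 /cvgr0Pnorm_lt h; apply/cvgr0Pnorm_lt => e /h.
apply: filterS => x; apply: le_lt_trans.
by rewrite normrM ler_piMl.
Qed.

Lemma asymp_lin k u v a b a' b' (p r : R) : asymp k u a b -> asymp k v a' b' ->
  asymp k (fun x => p * u x + r * v x) (p * a + r * a') (p * b + r * b').
Proof.
move=> hu hv.
have : p * (u x - (a * cos (k * x) + b * sin (k * x))) +
    r * (v x - (a' * cos (k * x) + b' * sin (k * x))) @[x --> F] -->
    p * 0 + r * 0.
  by apply: cvgD; apply: cvgMr.
rewrite !mulr0 addr0; apply: cvg_trans; apply: near_eq_cvg; apply: nearW => x.
by ring.
Qed.

(** Shifting x by a quarter period turns the profile into its quadrature, so
    rotating the two back recovers a and b as limits of functions tending to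
    zero. *)
Lemma asymp0 k a b : k != 0 -> asymp k (fun=> 0) a b -> a = 0 /\ b = 0.
Proof.
move=> k0 h.
pose g x := 0 - (a * cos (k * x) + b * sin (k * x)).
have h2 : g (x + pi / 2 / k) @[x --> F] --> (0 : R).
  exact: (cvg_comp _ _ (shiftF (pi / 2 / k)) h).
have gs x : g (x + pi / 2 / k) = a * sin (k * x) - b * cos (k * x).
  have e : k * (x + pi / 2 / k) = k * x + pi / 2 by field.
  by rewrite /g e cosDpihalf sinDpihalf; ring.
have {}h2 : a * sin (k * x) - b * cos (k * x) @[x --> F] --> (0 : R).
  by move: h2; under eq_fun do rewrite gs.
have cle x : `|cos (k * x)| <= 1 by exact: cos_max.
have sle x : `|sin (k * x)| <= 1 by exact: sin_max.
have hc := cvg0_bounded_mul _ _ cle h; have hs := cvg0_bounded_mul _ _ sle h.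
have hc2 := cvg0_bounded_mul _ _ cle h2; have hs2 := cvg0_bounded_mul _ _ sle h2.
have lim0 (l : R) (u v : R -> R) : u x @[x --> F] --> (0 : R) ->
    v x @[x --> F] --> (0 : R) -> (forall x, u x + v x = l) -> l = 0.
  move=> u0 v0 e; have : u x + v x @[x --> F] --> (0 + 0 : R) by exact: cvgD.
  rewrite addr0; under eq_fun do rewrite e.
  by move/(cvg_lim (@Rhausdorff R)) <-; rewrite lim_cst.
have hs2' : - (sin (k * x) * (a * sin (k * x) - b * cos (k * x))) @[x --> F]
    --> (0 : R) by rewrite -[X in _ --> X]oppr0; exact: cvgN.
split; apply/eqP; rewrite -oppr_eq0; apply/eqP.
- apply: (lim0 _ _ _ hc hs2') => x; rewrite /g.
  by rewrite -[RHS]mulr1 -(cos2Dsin2 (k * x)); ring.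
- apply: (lim0 _ _ _ hs hc2) => x /=.
  by rewrite -[RHS]mulr1 -(cos2Dsin2 (k * x)); ring.
Qed.

Lemma asymp_uniq k u a b a' b' : k != 0 -> asymp k u a b -> asymp k u a' b' ->
  a = a' /\ b = b'.
Proof.
move=> k0 h1 h2; have := asymp_lin _ _ _ _ _ _ _ 1 (-1) h1 h2.
have -> : (fun x => 1 * u x + -1 * u x) = (fun=> 0) by apply/funext => x; ring.
by move/(asymp0 _ _ _ k0) => [] ha hb; split; lra.
Qed.

(** The limits of the rotating coordinates are the amplitudes of cos and
    sin. *)
Lemma asymp_rotate k (Y : bool -> R -> R) a b :
  Y true x @[x --> F] --> a -> Y false x @[x --> F] --> b ->
  asymp k (rotate k Y) a b.
Proof.
move=> ha hb.
have h1 : cos (k * x) * (Y true x - a) @[x --> F] --> (0 : R).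
  apply: cvg0_bounded_mul => [x|]; first exact: cos_max.
  by rewrite -[X in _ --> X](subrr a); apply: cvgB ha _; exact: cvg_cst.
have h2 : sin (k * x) * (Y false x - b) @[x --> F] --> (0 : R).
  apply: cvg0_bounded_mul => [x|]; first exact: sin_max.
  by rewrite -[X in _ --> X](subrr b); apply: cvgB hb _; exact: cvg_cst.
have : cos (k * x) * (Y true x - a) + sin (k * x) * (Y false x - b)
    @[x --> F] --> (0 + 0 : R) by exact: cvgD h1 h2.
rewrite addr0.
apply: cvg_trans; apply: near_eq_cvg; apply: nearW => x.
by rewrite /rotate /=; ring.
Qed.

End Asymptotics.

(** * Jost solutions in real and imaginary parts *)

Section ComplexJost.
Context {R : realType}.
Local Notation C := R[i].
Local Notation reC := (@complex.Re R).
Local Notation imC := (@complex.Im R).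

Lemma ReD (z t : C) : reC (z + t) = reC z + reC t.
Proof. by case: z t => [? ?] []. Qed.
Lemma ImD (z t : C) : imC (z + t) = imC z + imC t.
Proof. by case: z t => [? ?] []. Qed.
Lemma ReN (z : C) : reC (- z) = - reC z. Proof. by case: z. Qed.
Lemma ImN (z : C) : imC (- z) = - imC z. Proof. by case: z. Qed.
Definition Re_ImE := (ReD, ImD, ReN, ImN, (@Re_mul R), (@Im_mul R)).

Lemma complex_ext (z t : C) : reC z = reC t -> imC z = imC t -> z = t.
Proof. by case: z t => [? ?] [? ?] /= -> ->. Qed.

(** For real q and real k the equation has real coefficients, so it
    decouples into the real and imaginary parts. *)
Lemma eigen_odeP (q : R -> R) (k : R) (f : R -> C) :
  eigen_ode q k%:C f <->
  (exists y', solution (fun x => q x + k ^+ 2) (reC \o f) y') /\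
  (exists y', solution (fun x => q x + k ^+ 2) (imC \o f) y').
Proof.
split.
  move=> [df ddf e]; split.
    exists (derive1 (reC \o f)); split=> x.
      by rewrite derive1E; apply: derivableP; exact: (df x).1.
    have -> : - ((q x + k ^+ 2) * (reC \o f) x) = derive1 (reC \o cderive f) x.
      by have := congr1 reC (e x); rewrite !(expr2, Re_ImE) /=; lra.
    by rewrite derive1E; apply: derivableP; exact: (ddf x).1.
  exists (derive1 (imC \o f)); split=> x.
    by rewrite derive1E; apply: derivableP; exact: (df x).2.
  have -> : - ((q x + k ^+ 2) * (imC \o f) x) = derive1 (imC \o cderive f) x.
    by have := congr1 imC (e x); rewrite !(expr2, Re_ImE) /=; lra.
  by rewrite derive1E; apply: derivableP; exact: (ddf x).2.
move=> [[yr [dr ddr]] [yi [di ddi]]].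
have er : derive1 (reC \o f) = yr.
  by apply/funext => x; rewrite derive1E; exact: derive_val.
have ei : derive1 (imC \o f) = yi.
  by apply/funext => x; rewrite derive1E; exact: derive_val.
have er' : reC \o cderive f = yr by apply/funext => x /=; rewrite er.
have ei' : imC \o cderive f = yi by apply/funext => x /=; rewrite ei.
split=> [x|x|x].
- by split; exact: ex_derive.
- by rewrite er' ei'; split; exact: ex_derive.
have h1 : derive1 yr x = - ((q x + k ^+ 2) * (reC \o f) x).
  by rewrite derive1E; exact: derive_val.
have h2 : derive1 yi x = - ((q x + k ^+ 2) * (imC \o f) x).
  by rewrite derive1E; exact: derive_val.
apply: complex_ext; rewrite !(expr2, Re_ImE) /=.
  by rewrite er' h1 /=; ring.
by rewrite ei' h2 /=; ring.
Qed.

Lemma cexp_imaginary (k x : R) :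
  cexp ('i%C * k%:C * x%:C) = cos (k * x) +i* sin (k * x).
Proof.
have -> : 'i%C * k%:C * x%:C = 0 +i* (k * x) :> C.
  by apply: complex_ext; rewrite !Re_ImE /=; ring.
rewrite /cexp /= expR0; apply: complex_ext; rewrite !Re_ImE /=; ring.
Qed.

(** Multiplying by exp (- i k x), of modulus 1, turns the normalization into
    f = cos (k x) - i sin (k x) + o(1). *)
Lemma phaseP (F : set_system R) (PF : ProperFilter F) (k : R) (f : R -> C) :
  (cexp ('i%C * k%:C * x%:C) * f x @[x --> F] --> (1 : C^o)) <->
  asymp F k (reC \o f) 1 0 /\ asymp F k (imC \o f) 0 (-1).
Proof.
rewrite cvg_ReIm.
under eq_fun do rewrite cexp_imaginary Re_ImE /=.
under [X in _ /\ (X @ _ --> _) <-> _]eq_fun do rewrite cexp_imaginary Re_ImE /=.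
have cle x : `|cos (k * x)| <= 1 by exact: cos_max.
have sle x : `|sin (k * x)| <= 1 by exact: sin_max.
have tw (u v a b : R -> R) : (forall x, `|a x| <= 1) -> (forall x, `|b x| <= 1) ->
    u x @[x --> F] --> (0 : R) -> v x @[x --> F] --> (0 : R) ->
    a x * u x + b x * v x @[x --> F] --> (0 : R).
  move=> a1 b1 u0 v0; rewrite -[X in _ --> X]addr0.
  by apply: cvgD; exact: cvg0_bounded_mul.
have Nsle x : `|- sin (k * x)| <= 1 by rewrite normrN.
have c2s2 x : cos (k * x) ^+ 2 + sin (k * x) ^+ 2 = 1 by exact: cos2Dsin2.
split=> [[hA hB]|[hr hi]].
  have {}hA : (cos (k * x) * reC (f x) - sin (k * x) * imC (f x)) - 1
      @[x --> F] --> (0 : R).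
    by rewrite -[X in _ --> X](subrr 1); apply: cvgB hA _; exact: cvg_cst.
  split; rewrite /asymp /=.
    apply: cvg_trans (tw _ _ _ _ cle sle hA hB).
    apply: near_eq_cvg; apply: nearW => x /=.
    by rewrite -[X in _ = X - _]mul1r -(c2s2 x); ring.
  apply: cvg_trans (tw _ _ _ _ cle Nsle hB hA).
  apply: near_eq_cvg; apply: nearW => x /=.
  by rewrite -[X in _ = X - _]mul1r -(c2s2 x); ring.
split.
  have h : 1 + (cos (k * x) * (reC (f x) - (1 * cos (k * x) + 0 * sin (k * x))) +
     - sin (k * x) * (imC (f x) - (0 * cos (k * x) + -1 * sin (k * x))))
     @[x --> F] --> 1 + (0 : R).
    by apply: cvgD; [exact: cvg_cst | exact: tw].
  move: h; rewrite addr0 /=; apply: cvg_trans.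
  apply: near_eq_cvg; apply: nearW => x /=.
  by rewrite -{1}(c2s2 x); ring.
have h := tw _ _ _ _ cle sle hi hr.
move: h; rewrite /=; apply: cvg_trans.
apply: near_eq_cvg; apply: nearW => x /=.
by ring.
Qed.

Lemma asympN (F : set_system R) (k : R) (u : R -> R) (a b : R) :
  asymp F (- k) u a b <-> asymp F k u a (- b).
Proof.
rewrite /asymp; have -> // : (fun x => u x - (a * cos (- k * x) + b * sin (- k * x)))
  = (fun x => u x - (a * cos (k * x) + - b * sin (k * x))).
by apply/funext => x; rewrite mulNr cosN sinN; ring.
Qed.

Section Normalization.
Variables (F : set_system R) (PF : ProperFilter F).
Hypothesis shiftF : forall s : R, x + s @[x --> F] --> F.
Variables (q u1 u1' u2 u2' : R -> R) (k W : R).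
Hypotheses (k0 : k != 0) (W0 : W != 0).
Hypothesis s1 : solution (fun x => q x + k ^+ 2) u1 u1'.
Hypothesis s2 : solution (fun x => q x + k ^+ 2) u2 u2'.
Hypothesis wr : forall x, u1 x * u2' x - u1' x * u2 x = W.
Hypothesis a1 : asymp F k u1 1 0.
Hypothesis a2 : asymp F k u2 0 1.

Lemma asymp_combination (p r : R) : asymp F k (fun x => p * u1 x + r * u2 x) p r.
Proof.
have := asymp_lin F PF k u1 u2 1 0 0 1 p r a1 a2.
by rewrite !mulr1 !mulr0 addr0 add0r.
Qed.

Lemma solution_from_asymp y y' (a b : R) : solution (fun x => q x + k ^+ 2) y y' ->
  asymp F k y a b -> y = fun x => a * u1 x + b * u2 x.
Proof.
move=> sy ya; have [p [r e]] := solution_span _ _ _ _ _ _ s1 s2 wr W0 _ _ sy.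
have ye : y = fun x => p * u1 x + r * u2 x by apply/funext.
have := asymp_combination p r; rewrite -ye => yp.
by have [<- <-] := asymp_uniq F PF shiftF k y p r a b k0 yp ya.
Qed.

Lemma solution_combination p r : solution (fun x => q x + k ^+ 2)
  (fun x => p * u1 x + r * u2 x) (fun x => p * u1' x + r * u2' x).
Proof.
have [d1 d1'] := s1; have [d2 d2'] := s2.
split=> x.
  exact: (is_deriveD (is_deriveZ p (d1 x)) (is_deriveZ r (d2 x))).
apply: (@is_derive_eq _ _ _ _ _ _ _ _
  (is_deriveD (is_deriveZ p (d1' x)) (is_deriveZ r (d2' x)))).
by rewrite /GRing.scale /=; ring.
Qed.

(** A real basis with the profiles cos (k x) and sin (k x) at one end
    identifies the Jost solution normalized there, and gives existence and
    uniqueness together. The wave number kap of the equation and the k of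
    the profiles may differ in sign, since only the square of kap enters. *)
Lemma jost_normalization (kap s : R) : kap ^+ 2 = k ^+ 2 ->
  forall f : R -> C,
  (eigen_ode q kap%:C f /\
   asymp F k (reC \o f) 1 0 /\ asymp F k (imC \o f) 0 s) <->
  f = fun x => u1 x +i* (s * u2 x).
Proof.
move=> kk f; rewrite eigen_odeP kk; split.
  move=> [[[yr sr] [yi si]] [ar ai]]; apply/funext => x.
  have er := congr1 (fun g => g x) (solution_from_asymp _ _ _ _ sr ar).
  have ei := congr1 (fun g => g x) (solution_from_asymp _ _ _ _ si ai).
  apply: complex_ext; rewrite /= in er ei *; rewrite ?er ?ei; ring.
move=> ->.
have e1 : reC \o (fun x => u1 x +i* (s * u2 x)) = fun x => 1 * u1 x + 0 * u2 x.
  by apply/funext => x /=; ring.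
have e2 : imC \o (fun x => u1 x +i* (s * u2 x)) = fun x => 0 * u1 x + s * u2 x.
  by apply/funext => x /=; ring.
rewrite e1 e2; split; split.
- by eexists; exact: solution_combination.
- by eexists; exact: solution_combination.
- exact: asymp_combination.
- exact: asymp_combination.
Qed.

End Normalization.

End ComplexJost.

(** * The scattering coefficients in terms of the fundamental matrix *)

Section Scattering.
Context {R : realType}.
Local Notation C := R[i].
Local Notation reC := (@complex.Re R).
Local Notation imC := (@complex.Im R).
Local Notation mu := (@lebesgue_measure R).
Variables (w w' : R -> R) (c : R).
Hypothesis dw : forall x : R, is_derive x (1 : R) w (w' x).
Hypothesis decay0 : decays c w.
Hypothesis decay1 : decays c (fun x => x * w x).

Local Notation I := (\int[mu]_x w x).
Local Notation q := (fun x => w' x - w x ^+ 2).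

Lemma shiftNy (s : R) : x + s @[x --> -oo] --> -oo.
Proof.
apply/cvgrNyPle => A; near=> x; rewrite -lerBrDr.
by near: x; apply: nbhs_ninfty_le; exact: num_real.
Unshelve. all: by end_near. Qed.

(** One basis serves both k and - k, as cos is even and sin is odd. *)
Lemma jost_plusE (u1 u1' u2 u2' : R -> R) (k W : R) : k != 0 -> W != 0 ->
  solution (fun x => q x + k ^+ 2) u1 u1' ->
  solution (fun x => q x + k ^+ 2) u2 u2' ->
  (forall x, u1 x * u2' x - u1' x * u2 x = W) ->
  asymp +oo k u1 1 0 -> asymp +oo k u2 0 1 ->
  jost_plus q k%:C = (fun x => u1 x +i* (1 * u2 x)) /\
  jost_plus q (- k)%:C = (fun x => u1 x +i* (-1 * u2 x)).
Proof.
move=> k0 W0 s1 s2 wr a1 a2.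
have char kap s : kap ^+ 2 = k ^+ 2 ->
    (forall f : R -> C,
      cexp (- ('i%C * kap%:C * x%:C)) * f x @[x --> +oo] --> (1 : C^o) <->
      asymp +oo k (reC \o f) 1 0 /\ asymp +oo k (imC \o f) 0 s) ->
    jost_plus q kap%:C = fun x => u1 x +i* (s * u2 x).
  move=> kk ph.
  have N := jost_normalization +oo _ (@cvg_addrr R) q u1 u1' u2 u2' k W k0 W0 s1 s2 wr
    a1 a2 kap s kk.
  apply: xget_unique => [|f [ef pf]].
    by have [h1 h2] := (N _ _).2 erefl; split=> //; apply/ph.
  by apply/N; split=> //; exact/ph.
have phase kap f : cexp (- ('i%C * kap%:C * x%:C)) * f x @[x --> +oo]
      --> (1 : C^o) <->
    asymp +oo (- kap) (reC \o f) 1 0 /\ asymp +oo (- kap) (imC \o f) 0 (-1).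
  rewrite -phaseP; have -> // : (fun x : R => cexp (- ('i%C * kap%:C * x%:C)) * f x)
    = (fun x => cexp ('i%C * (- kap)%:C * x%:C) * f x).
  by apply/funext => x; rewrite rmorphN mulrN mulNr.
split.
- by apply: char => // f; rewrite phase !asympN oppr0 opprK.
- by apply: char => [|f]; [rewrite sqrrN | rewrite phase opprK].
Qed.

Lemma jost_minusE (u1 u1' u2 u2' : R -> R) (k W : R) : k != 0 -> W != 0 ->
  solution (fun x => q x + k ^+ 2) u1 u1' ->
  solution (fun x => q x + k ^+ 2) u2 u2' ->
  (forall x, u1 x * u2' x - u1' x * u2 x = W) ->
  asymp -oo k u1 1 0 -> asymp -oo k u2 0 1 ->
  jost_minus q k%:C = (fun x => u1 x +i* (-1 * u2 x)).
Proof.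
move=> k0 W0 s1 s2 wr a1 a2.
have N := jost_normalization -oo _ shiftNy q u1 u1' u2 u2' k W k0 W0 s1 s2 wr
    a1 a2 k (-1) erefl.
apply: xget_unique => [|f [ef pf]].
  by have [h1 h2] := (N _ _).2 erefl; split=> //; apply/phaseP.
by apply/N; split=> //; exact/phaseP.
Qed.

(** The columns of the fundamental matrix give u true and u false, with f_-
    = u true - i u false. Inverting m, of determinant 1, gives the basis p1,
    p2 normalized at + oo, with f_+(k) = p1 + i p2 and f_+(- k) = p1 - i p2.
    Then u true = m11 p1 + m21 p2 and u false = m12 p1 + m22 p2, and
    comparing the coefficients of p1 and p2 determines a and b. *)
Lemma scattering_formula (k : R) : k != 0 -> exists m : bool -> bool -> R,
  (forall j, `|m true j * expR I - (true == j)%:R| <= frequency_rate c * `|k| /\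
             `|m false j * expR (- I) - (false == j)%:R| <=
                  frequency_rate c * `|k|) /\
  scattering q k =
   (((m true true + m false false) / 2) +i* ((m false true - m true false) / 2),
    ((m true true - m false false) / 2) +i* (- (m false true + m true false) / 2)).
Proof.
move=> k0.
have [m [Y [dY Y0 Ym [det detm] rate]]] :=
  fundamental_matrix w w' c dw decay0 decay1 k.
exists m; split=> //.
pose u j := rotate k (Y j).
pose u' j x := - (w x * u j x) + k * corotate k (Y j) x.
have su j : solution (fun x => q x + k ^+ 2) (u j) (u' j).
  exact: rotate_solution.
have wu x : u true x * u' false x - u' true x * u false x = k.
  rewrite -[RHS]mulr1 -(det x) /u' /u /rotate /corotate.
  rewrite -[Y true true x * Y false false x - _]mulr1 -(cos2Dsin2 (k * x)).
  by ring.
have am : asymp -oo k (u true) 1 0 by apply: asymp_rotate; exact: Y0.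
have am' : asymp -oo k (u false) 0 1 by apply: asymp_rotate; exact: Y0.
have ap j : asymp +oo k (u j) (m true j) (m false j).
  by apply: asymp_rotate; exact: Ym.
(* The coefficients are the columns of the inverse of m. *)
pose p1 x := m false false * u true x + - m false true * u false x.
pose p2 x := - m true false * u true x + m true true * u false x.
have eu1 x : u true x = m true true * p1 x + m false true * p2 x.
  by rewrite /p1 /p2 -[LHS]mul1r -detm; ring.
have eu2 x : u false x = m true false * p1 x + m false false * p2 x.
  by rewrite /p1 /p2 -[LHS]mul1r -detm; ring.
have sp1 := solution_combination q _ _ _ _ k (su true) (su false)
  (m false false) (- m false true).
have sp2 := solution_combination q _ _ _ _ k (su true) (su false)
  (- m true false) (m true true).
have ap1 : asymp +oo k p1 1 0.
  have h := asymp_lin +oo _ k _ _ _ _ _ _ (m false false) (- m false true)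
    (ap true) (ap false).
  rewrite (_ : m false false * m true true + - m false true * m true false = 1)
    in h; last by rewrite -detm; ring.
  rewrite (_ : m false false * m false true + - m false true * m false false = 0)
    in h; last by ring.
  exact: h.
have ap2 : asymp +oo k p2 0 1.
  have h := asymp_lin +oo _ k _ _ _ _ _ _ (- m true false) (m true true)
    (ap true) (ap false).
  rewrite (_ : - m true false * m true true + m true true * m true false = 0)
    in h; last by ring.
  rewrite (_ : - m true false * m false true + m true true * m false false = 1)
    in h; last by rewrite -detm; ring.
  exact: h.
have [jp jpN] := @jost_plusE p1 _ p2 _ k k k0 k0 sp1 sp2
  ltac:(by move=> x; rewrite -[RHS]mul1r -detm -(wu x) /p1 /p2; ring) ap1 ap2.
have jm := @jost_minusE _ _ _ _ k k k0 k0 (su true) (su false) wu am am'.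
rewrite /scattering jp jpN jm; apply: xget_unique => /=.
  move=> x; by rewrite eu1 eu2; apply: complex_ext; rewrite !Re_ImE /=; field.
move=> [[ar ai] [br bi]] /= e.
have e1 x : u true x = (ar + br) * p1 x + (ai - bi) * p2 x.
  by have := congr1 reC (e x); rewrite !Re_ImE /= => ->; ring.
have e2 x : u false x = (- ai - bi) * p1 x + (ar - br) * p2 x.
  by have := congr1 imC (e x); rewrite !Re_ImE /= mulN1r => /(congr1 -%R);
    rewrite opprK => ->; ring.
have comb (p r : R) := asymp_combination +oo _ _ _ k ap1 ap2 p r.
have uniq j (a b : R) : (forall x, u j x = a * p1 x + b * p2 x) ->
    a = m true j /\ b = m false j.
  move=> ej; have hj : asymp +oo k (u j) a b.
    have -> : u j = fun x => a * p1 x + b * p2 x by exact/funext.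
    exact: comb.
  exact: (asymp_uniq +oo _ (@cvg_addrr R) k _ _ _ _ _ k0 hj (ap j)).
have [h1 h2] := uniq _ _ _ e1; have [h3 h4] := uniq _ _ _ e2.
by congr (_, _); apply: complex_ext => /=; lra.
Qed.

End Scattering.

(** * Limits of the scattering data at zero energy *)

Section LowEnergyLimits.
Context {R : realType}.
Local Notation C := R[i].
Local Notation mu := (@lebesgue_measure R).
Variables (w w' : R -> R) (c : R).
Hypothesis dw : forall x : R, is_derive x (1 : R) w (w' x).
Hypothesis decay0 : decays c w.
Hypothesis decay1 : decays c (fun x => x * w x).

Local Notation I := (\int[mu]_x w x).
Local Notation q := (fun x => w' x - w x ^+ 2).

Lemma linear_rate_cvg (f : R -> R) (a D J : R) :
  (forall k, k != 0 -> `|f k * expR J - a| <= D * `|k|) ->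
  f k @[k --> 0^'] --> a * expR (- J).
Proof.
move=> h.
have h1 : f k * expR J @[k --> 0^'] --> a.
  apply/subr_cvg0; apply/norm_cvg0P.
  apply: (@squeeze_cvgr _ _ _ _ (fun=> 0) (fun k => D * `|k|)).
  - near=> k; rewrite normr_ge0/=; apply: h; near: k; exact: nbhs_dnbhs_neq.
  - exact: cvg_cst.
  - rewrite -[X in _ --> X](mulr0 D); apply: cvgMr.
    rewrite -[X in _ --> X](@normr0 _ R); apply: cvg_norm.
    exact: nbhs_dnbhs.
have e k : f k = f k * expR J * expR (- J).
  by rewrite -mulrA -expRD subrr expR0 mulr1.
rewrite (funext e : f = _); apply: cvgM => //; exact: cvg_cst.
Unshelve. all: by end_near. Qed.

Lemma scattering_cvg :
  (coef_a q k @[k --> 0^'] --> ((cosh I)%:C : C^o)) /\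
  (coef_b q k @[k --> 0^'] --> ((- sinh I)%:C : C^o)).
Proof.
have /choice[m hm] : forall k, exists m : bool -> bool -> R, k != 0 ->
  (forall j, `|m true j * expR I - (true == j)%:R| <= frequency_rate c * `|k| /\
             `|m false j * expR (- I) - (false == j)%:R| <=
                  frequency_rate c * `|k|) /\
  scattering q k =
   (((m true true + m false false) / 2) +i*
      ((m false true - m true false) / 2),
    ((m true true - m false false) / 2) +i*
      (- (m false true + m true false) / 2)).
  move=> k; have [->|k0] := eqVneq k 0.
    by exists (fun _ _ => 0) => /eqP.
  by have [m h] := scattering_formula w w' c dw decay0 decay1 k k0; exists m.
have mt j : m k true j @[k --> 0^'] --> (true == j)%:R * expR (- I).
  by apply: linear_rate_cvg => k /hm [/(_ j) [h _] _]; exact: h.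
have mf j : m k false j @[k --> 0^'] --> (false == j)%:R * expR (- - I).
  by apply: linear_rate_cvg => k /hm [/(_ j) [_ h] _]; exact: h.
have tt := mt true; have tf := mt false; have ft := mf true; have ff := mf false.
rewrite /= ?mul0r ?mul1r opprK in tt tf ft ff.
split.
- have h : ((m k true true + m k false false) / 2) +i*
      ((m k false true - m k true false) / 2) @[k --> 0^'] --> ((cosh I)%:C : C^o).
    apply/cvg_ReIm; split=> /=.
      by rewrite /cosh [X in X / 2]addrC; apply: cvgMl; exact: cvgD.
    have z : (0 - 0) / 2 = 0 :> R by rewrite subr0 mul0r.
    by rewrite -[X in _ --> X]z; apply: cvgMl; exact: cvgB.
  apply: cvg_trans h; apply: near_eq_cvg; near=> k.
  have k0 : k != 0 by near: k; exact: nbhs_dnbhs_neq.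
  by rewrite /coef_a (hm k k0).2.
- have h : ((m k true true - m k false false) / 2) +i*
      (- (m k false true + m k true false) / 2) @[k --> 0^'] -->
      ((- sinh I)%:C : C^o).
    apply/cvg_ReIm; split=> /=.
      by rewrite /sinh -mulNr opprB; apply: cvgMl; exact: cvgB.
    have z : - (0 + 0) / 2 = 0 :> R by rewrite addr0 oppr0 mul0r.
    by rewrite -[X in _ --> X]z; apply: cvgMl; apply: cvgN; exact: cvgD.
  apply: cvg_trans h; apply: near_eq_cvg; near=> k.
  have k0 : k != 0 by near: k; exact: nbhs_dnbhs_neq.
  by rewrite /coef_b (hm k k0).2.
Unshelve. all: by end_near. Qed.

Lemma cosh_neq0 (x : R) : cosh x != 0.
Proof.
rewrite /cosh; have := expR_gt0 x; have := expR_gt0 (- x) => h1 h2.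
by apply/eqP => h; lra.
Qed.

Lemma transmission_reflection_cvg :
  (transmission q k @[k --> 0^'] --> ((sech I)%:C : C^o)) /\
  (reflection q k @[k --> 0^'] --> ((- tanh I)%:C : C^o)).
Proof.
have [ha hb] := scattering_cvg.
have c0 : (cosh I)%:C != 0 :> C.
  by rewrite (_ : 0 = (0 : R)%:C)// (inj_eq (@complexI R)) cosh_neq0.
have hT : transmission q k @[k --> 0^'] --> ((sech I)%:C : C^o).
  have -> : (sech I)%:C = ((cosh I)%:C : C)^-1 by rewrite /sech fmorphV.
  exact: (@cvgV _ _ _ _ (coef_a q : R -> C^o) _ c0 ha).
split; first exact: hT.
have -> : (- tanh I)%:C = (- sinh I)%:C * (sech I)%:C :> C.
  by rewrite -rmorphM /tanh /sech mulNr.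
exact: (@cvgM _ _ _ _ (coef_b q : R -> C^o) (transmission q : R -> C^o) _ _ hb hT).
Qed.

End LowEnergyLimits.

(** * Linear dependence at zero energy *)

Section ZeroEnergy.
Context {R : realType}.
Local Notation C := R[i].
Local Notation reC := (@complex.Re R).
Local Notation imC := (@complex.Im R).
Local Notation mu := (@lebesgue_measure R).
Variables (w w' : R -> R) (c : R).
Hypothesis dw : forall x : R, is_derive x (1 : R) w (w' x).
Hypothesis decay0 : decays c w.

Local Notation q := (fun x => w' x - w x ^+ 2).

Let cw : continuous w. Proof. exact: is_derive_continuous dw. Qed.

Let wi : mu.-integrable [set: R] (EFin \o w).
Proof. exact: decays_integrable decay0. Qed.

Let dS (x : R) : is_derive x (1 : R) (primitive w) (w x).
Proof. exact: is_derive_primitive. Qed.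

Let Sb x : `|primitive w x| <= c * pi.
Proof. exact: primitive_bound. Qed.

Let dexp (s x : R) : is_derive x (1 : R) (fun x => expR (s * primitive w x))
  (s * w x * expR (s * primitive w x)).
Proof.
apply: (@is_derive_eq _ _ _ _ _ _ _ _
    (@is_derive1_comp _ expR _ x _ _ (is_derive_expR _) (is_deriveZ s (dS x)))).
by rewrite /GRing.scale /= mulrC.
Qed.

(** The solution annihilated by the factor u' + w u; it is bounded above and
    away from zero because w is integrable. *)
Definition zero_mode (x : R) : R := expR (- 1 * primitive w x).

Lemma zero_mode_solution :
  solution (fun x => q x + 0 ^+ 2) zero_mode (fun x => - 1 * w x * zero_mode x).
Proof.
split=> x; first exact: dexp.
apply: (@is_derive_eq _ _ _ _ _ _ _ _
  (is_deriveM (is_deriveZ (-1) (dw x)) (dexp (-1) x))).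
by rewrite /GRing.scale /zero_mode /= scaleN1r; ring.
Qed.

(** The quotient h = y / zero_mode satisfies h' = - D * zero_mode ^ (- 2)
    with D the wronskian. As zero_mode ^ (- 2) is bounded below, h (x + 1) -
    h x stays away from zero unless D = 0; but it tends to zero where y and
    zero_mode converge, and the limit of zero_mode is not zero. *)
Lemma convergent_zero_energy_solution (F : set_system R) (PF : ProperFilter F)
  (y y' : R -> R) (s l : R) : (forall s : R, x + s @[x --> F] --> F) ->
  primitive w x @[x --> F] --> s -> y x @[x --> F] --> l ->
  solution (fun x => q x + 0 ^+ 2) y y' ->
  exists a, forall x, y x = a * zero_mode x.
Proof.
move=> shiftF Ss yl sy.
have [D hD] := wronskian_cst _ _ _ _ _ sy zero_mode_solution.
pose h x := y x * expR (1 * primitive w x).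
have ee x : expR (1 * primitive w x) * zero_mode x = 1.
  by rewrite /zero_mode -expRD mul1r mulN1r subrr expR0.
have dh (x : R) : is_derive x (1 : R) h (- D * expR (2 * primitive w x)).
  apply: (@is_derive_eq _ _ _ _ _ _ _ _ (is_deriveM (sy.1 x) (dexp 1 x))).
  have -> : expR (2 * primitive w x) =
      expR (1 * primitive w x) * expR (1 * primitive w x).
    by rewrite (_ : 2 * _ = 1 * primitive w x + 1 * primitive w x) ?expRD//; ring.
  rewrite /GRing.scale /= -(hD x). move: (ee x).
  move: (expR _) (zero_mode x) (w x) (y x) (y' x) => e z w0 y0 y1 ez.
  transitivity (e * (y1 + w0 * y0) * (e * z)); last by ring.
  by rewrite ez; ring.
(* Lower bound of the derivative of - D * h, from |S| <= c * pi. *)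
pose d := D ^+ 2 * expR (- (2 * (c * pi))).
have D0 : d <= 0.
  have dg (x : R) : is_derive x (1 : R) (fun x => (- D) * h x - d * x)
      (D ^+ 2 * expR (2 * primitive w x) - d).
    apply: (@is_derive_eq _ _ _ _ _ _ _ _
      (is_deriveB (is_deriveZ (- D) (dh x)) (is_derive_scale d x))).
    by rewrite /GRing.scale /=; ring.
  have mono := derive_ge0_homo _ _ dg _.
  have ge x : d <= - D * (h (x + 1) - h x).
    have := mono _ x (x + 1); rewrite lerDl ler01 => /(_ _ isT) H.
    have {}H := H _; suff : - D * h x - d * x <= - D * h (x + 1) - d * (x + 1).
      by lra.
    apply: H => z; rewrite subr_ge0 /d; apply: ler_wpM2l; first exact: sqr_ge0.
    by rewrite ler_expR; have := Sb z; rewrite ler_norml; lra.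
  have hl : h x @[x --> F] --> l * expR (1 * s).
    have Ss1 : 1 * primitive w x @[x --> F] --> 1 * s by apply: cvgMr.
    apply: cvgM => //; exact: (cvg_comp _ _ Ss1 (@continuous_expR R _)).
  have hl1 : h (x + 1) @[x --> F] --> l * expR (1 * s).
    exact: (cvg_comp _ _ (shiftF 1) hl).
  have lim0 : - D * (h (x + 1) - h x) @[x --> F] --> (0 : R).
    rewrite -[X in _ --> X](mulr0 (- D)); apply: cvgMr.
    rewrite -[X in _ --> X](subrr (l * expR (1 * s))).
    exact: (cvgB hl1 hl).
  by apply: (cvgr_to_ge lim0); exact: nearW.
have {}D0 : D = 0.
  apply/eqP; rewrite -sqrf_eq0 eq_le sqr_ge0 andbT.
  by rewrite -(pmulr_lle0 _ (expR_gt0 (- (2 * (c * pi))))).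
exists (h 0) => x.
have -> : h 0 = h x.
  apply: is_derive_0_is_cst => z.
  by apply: (@is_derive_eq _ _ _ _ _ _ _ _ (dh z)); rewrite D0 oppr0 mul0r.
by rewrite /h -mulrA ee mulr1.
Qed.

Lemma zero_energy_jost (F : set_system R) (PF : ProperFilter F)
  (s : R) (f : R -> C) : (forall s : R, x + s @[x --> F] --> F) ->
  primitive w x @[x --> F] --> s ->
  eigen_ode q 0 f ->
  (cexp ('i%C * 0 * x%:C) * f x @[x --> F] --> (1 : C^o)) ->
  exists z : C, forall x, f x = z * (zero_mode x)%:C.
Proof.
move=> shiftF Ss /(eigen_odeP q 0 f).1 [[yr sr] [yi si]].
move=> /(phaseP F PF 0 f).1 [ar ai].
have lim (y : R -> R) (a b : R) : asymp F 0 y a b -> y x @[x --> F] --> a.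
  move=> h; apply/subr_cvg0; move: h; apply: cvg_trans.
  apply: near_eq_cvg; apply: nearW => x /=.
  by rewrite mul0r cos0 sin0; ring.
have [a ha] := convergent_zero_energy_solution F PF _ _ s _ shiftF Ss (lim _ _ _ ar) sr.
have [b hb] := convergent_zero_energy_solution F PF _ _ s _ shiftF Ss (lim _ _ _ ai) si.
exists (a +i* b) => x; apply: complex_ext; rewrite !Re_ImE /= mulr0.
  by rewrite subr0; exact: ha.
by rewrite add0r; exact: hb.
Qed.

(** Each of the two solutions is a multiple of the zero mode. The case where
    no Jost solution exists is covered by the multiple 0, the default value
    of the choice. *)
Lemma zero_energy_linearly_dependent :
  linearly_dependent (jost_minus q 0) (jost_plus q 0).
Proof.
have [z1 h1] : exists z : C, forall x, jost_minus q 0 x = z * (zero_mode x)%:C.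
  rewrite /jost_minus; case: xgetP => [g _ [ode lim]|_]; last first.
    by exists 0 => x; rewrite mul0r.
  exact: (zero_energy_jost -oo _ 0 _ shiftNy (primitive_cvgNy _ wi) ode lim).
have [z2 h2] : exists z : C, forall x, jost_plus q 0 x = z * (zero_mode x)%:C.
  rewrite /jost_plus; case: xgetP => [g _ [ode lim]|_]; last first.
    by exists 0 => x; rewrite mul0r.
  apply: (zero_energy_jost +oo _ _ _ (@cvg_addrr R) (primitive_cvgy _ wi) ode).
  move: lim; apply: cvg_trans; apply: near_eq_cvg; apply: nearW => x.
  by rewrite mulr0 mul0r oppr0.
have [z10|z10] := eqVneq z1 0.
  exists 1, 0; split=> [[] /eqP|x]; first by rewrite oner_eq0.
  by rewrite h1 z10 mul0r mulr0 mul0r addr0.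
exists z2, (- z1); split=> [[_ /eqP]|x]; first by rewrite oppr_eq0 (negbTE z10).
by rewrite h1 h2; ring.
Qed.

End ZeroEnergy.

(** * Locally absolutely continuous functions *)

Section AbsolutelyContinuous.
Context {R : realType}.
Local Notation mu := (@lebesgue_measure R).
Implicit Types (f g F G : R -> R).

Lemma integrable_subitv f (a b x y : R) : a <= x -> y <= b ->
  mu.-integrable `[a, b] (EFin \o f) -> mu.-integrable `[x, y] (EFin \o f).
Proof.
by move=> ax yb; apply: integrableS => //; apply: subset_itv; rewrite bnd_simp.
Qed.

Lemma Rintegral_split f (x m y : R) : x <= m -> m <= y ->
  mu.-integrable `[x, y] (EFin \o f) ->
  \int[mu]_(t in `[x, y]) f t =
  \int[mu]_(t in `[x, m]) f t + \int[mu]_(t in `[m, y]) f t.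
Proof.
move=> xm my fi.
have := @Rintegral_itvB R f (BLeft x) (BRight y) m fi.
rewrite !bnd_simp => /(_ xm my) e.
rewrite -(@Rintegral_itv_obnd_cbnd R m (BRight y)) -?e; first by rewrite addrC subrK.
by apply: integrableS fi => //; apply: subset_itv; rewrite bnd_simp.
Qed.

Lemma continuous_itv_integrable f (a b : R) : continuous f ->
  mu.-integrable `[a, b] (EFin \o f).
Proof.
move=> cf; apply: continuous_compact_integrable; first exact: segment_compact.
exact: continuous_subspaceT.
Qed.

Lemma continuous_bounded_itv f (a b : R) : continuous f -> a <= b ->
  exists M, 0 <= M /\ forall t, a <= t <= b -> `|f t| <= M.
Proof.
move=> cf ab.
have cn : {within `[a, b], continuous (fun t => `|f t|)}.
  apply: continuous_subspaceT => t.
  by apply: continuous_comp; [exact: cf | exact: norm_continuous].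
have [m _ hm] := EVT_max ab cn.
by exists `|f m|; split=> // t tab; apply: hm; rewrite in_itv.
Qed.

Lemma ac_derivative_C1 F G : (forall x : R, is_derive x (1 : R) F (G x)) ->
  continuous G -> ac_derivative F G.
Proof.
move=> dF cG a b; split; first exact: continuous_itv_integrable.
have cF := is_derive_continuous _ _ dF.
move: H; rewrite le_eqVlt => /predU1P[->|ab].
  by rewrite subrr set_itv1 Rintegral_set1.
rewrite /Rintegral (@continuous_FTC2 R G F a b ab) //.
- exact: continuous_subspaceT.
- split.
  + by move=> x _; exact: ex_derive.
  + by apply: cvg_at_right_filter; exact: cF.
  + by apply: cvg_at_left_filter; exact: cF.
- by move=> x _; rewrite derive1E; exact: derive_val.
Qed.

Lemma Rintegral_cst_itv (r x y : R) : x <= y ->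
  \int[mu]_(t in `[x, y]) r = r * (y - x).
Proof.
move=> xy.
have cr : continuous (fun _ : R => r) by exact: cst_continuous.
by have [_ <-] := ac_derivative_C1 _ _ (is_derive_scale r) cr _ _ xy; ring.
Qed.

Lemma ac_derivative_continuous f g : ac_derivative f g -> continuous f.
Proof.
move=> fg x.
have lt1 : x - 1 < x + 1 by lra.
have [gi _] := fg (x - 1) (x + 1) (ltW lt1).
have := @parameterized_integral_continuous R (x - 1) (x + 1) g (ltW lt1) gi.
move=> /(continuous_within_itvP _ lt1).1 [/(_ x) ci _ _].
have {}ci : {for x, continuous
    (fun y => f (x - 1) + parameterized_integral mu (x - 1) y g)}.
  apply: cvgD; first exact: cvg_cst.
  by apply: ci; rewrite in_itv /=; apply/andP; split; lra.
rewrite /continuous_at.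
have e y : x - 1 <= y -> f y = f (x - 1) + parameterized_integral mu (x - 1) y g.
  by move=> xy; rewrite /parameterized_integral; have [_ <-] := fg _ _ xy; ring.
rewrite e; last by lra.
move: ci; rewrite /continuous_at; apply: cvg_trans; apply: near_eq_cvg.
near=> y; apply/esym/e/ltW; near: y; apply: lt_nbhsr; lra.
Unshelve. all: by end_near. Qed.

(** A function of the domain has a continuous weak derivative, hence a
    classical one, so that the product rule applies with it as the smooth
    factor. *)
Lemma ac_derivative_is_derive f g : ac_derivative f g -> continuous g ->
  forall x : R, is_derive x (1 : R) f (g x).
Proof.
move=> fg cg x.
have [] := @continuous_FTC1 R g (BLeft (x - 1)) x (x + 1) _ _ _ (cg x).
- by lra.
- exact: continuous_itv_integrable.
- by rewrite (@lte_fin R); lra.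
move=> d1 d2.
have dI : is_derive x (1 : R) (fun y => \int[mu]_(t in `[(x - 1), y]) g t) (g x).
  by apply: DeriveDef => //; rewrite -derive1E d2.
apply: near_eq_is_derive (is_derive_cstD (f (x - 1)) _ _ _ dI).
near=> y; have xy : x - 1 <= y by apply/ltW; near: y; apply: lt_nbhsr; lra.
by have [_ <-] := fg _ _ xy; ring.
Unshelve. all: by end_near. Qed.

End AbsolutelyContinuous.

(** * Product rule for absolutely continuous functions *)

Section ProductRule.
Context {R : realType}.
Local Notation mu := (@lebesgue_measure R).
Implicit Types (f g F : R -> R).

Lemma integrable_bounded_mul F f (A : set R) (M : R) : measurable A ->
  measurable_fun A F -> (forall t, A t -> `|F t| <= M) ->
  mu.-integrable A (EFin \o f) ->
  mu.-integrable A (EFin \o (fun t => F t * f t)).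
Proof.
move=> mA mF FM fi.
have mf : measurable_fun A f by apply/measurable_EFinP; case/integrableP: fi.
apply: (@le_integrable _ _ _ mu A mA _ (EFin \o (fun t => M * f t))).
- by apply/measurable_EFinP; exact: measurable_funM.
- move=> x Ax /=; rewrite lee_fin !normrM; apply: ler_wpM2r => //.
  exact: le_trans (FM _ Ax) (ler_norm _).
- have := integrableZl (mu := mu) mA M fi.
  by apply: eq_integrable => // x _ /=.
Qed.

(** Halving the interval n times bounds |D a b| by K * (b - a) * G a b / 2 ^
    n: each halving leaves the sum of the values of G unchanged and halves
    the lengths. *)
Lemma bisection_vanish (D G : R -> R -> R) (a b K : R) : a <= b ->
  (forall x m y, a <= x -> x <= m -> m <= y -> y <= b -> D x y = D x m + D m y) ->
  (forall x m y, a <= x -> x <= m -> m <= y -> y <= b -> G x y = G x m + G m y) ->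
  (forall x y, a <= x -> x <= y -> y <= b -> `|D x y| <= K * (y - x) * G x y) ->
  D a b = 0.
Proof.
move=> ab addD addG bnd.
have claim n : forall x y, a <= x -> x <= y -> y <= b ->
    `|D x y| <= K * (y - x) * G x y * 2^-1 ^+ n.
  elim: n => [|n IH] x y ax xy yb; first by rewrite expr0 mulr1; exact: bnd.
  pose m := (x + y) / 2.
  have xm : x <= m by rewrite /m; lra.
  have my : m <= y by rewrite /m; lra.
  rewrite (addD x m y)//; apply: le_trans (ler_normD _ _) _.
  apply: le_trans (lerD (IH x m ax xm (le_trans my yb))
    (IH m y (le_trans ax xm) my yb)) _.
  rewrite le_eqVlt; apply/orP; left; apply/eqP.
  rewrite (addG x m y)// exprS.
  have -> : m - x = (y - x) / 2 by rewrite /m; field.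
  have -> : y - m = (y - x) / 2 by rewrite /m; field.
  by move: (2^-1 ^+ n) (G x m) (G m y) => r g1 g2; field.
apply: (@eq_of_half_powers _ _ _ (K * (b - a) * G a b)) => n.
by rewrite subr0; exact: claim.
Qed.

(** The defect D x y between the increment of F * f over [x, y] and the
    integral of the expected derivative is the integral over t of (F y - F
    t) * g t + (f x - f t) * F' t. With F Lipschitz of constant L on [a, b],
    both terms are at most L * (y - x) times the integral of |g| over [x,
    y], and [bisection_vanish] applies. *)
Lemma ac_derivative_mul F F' f g :
  (forall x : R, is_derive x (1 : R) F (F' x)) -> continuous F' ->
  ac_derivative f g ->
  ac_derivative (fun x => F x * f x) (fun x => F' x * f x + F x * g x).
Proof.
move=> dF cF' fg a b ab.
have cF := is_derive_continuous _ _ dF.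
have cf := ac_derivative_continuous _ _ fg.
have FF' := ac_derivative_C1 _ _ dF cF'.
have [gi _] := fg _ _ ab.
have cF'f : continuous (fun x => F' x * f x).
  by move=> x; apply: cvgM; [exact: cF' | exact: cf].
have [M [M0 hM]] := continuous_bounded_itv F a b cF ab.
have [L [L0 hL]] := continuous_bounded_itv F' a b cF' ab.
have iFg : mu.-integrable `[a, b] (EFin \o (fun x => F x * g x)).
  have FM t : `[a, b]%classic t -> `|F t| <= M.
    by rewrite /= in_itv /=; exact: hM.
  apply: (integrable_bounded_mul F g _ M (measurable_itv _) _ FM gi).
  by apply: measurable_funTS; exact: continuous_measurable_fun.
have iF'f x y : mu.-integrable `[x, y] (EFin \o (fun x => F' x * f x)).
  exact: continuous_itv_integrable.
have iF' x y : mu.-integrable `[x, y] (EFin \o F').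
  exact: continuous_itv_integrable.
pose H t := F' t * f t + F t * g t.
have iH : mu.-integrable `[a, b] (EFin \o H).
  have := integrableD (mu := mu) (measurable_itv _) (iF'f a b) iFg.
  by apply: eq_integrable => // x _.
split; first exact: iH.
pose G x y := \int[mu]_(t in `[x, y]) `|g t|.
have ing : mu.-integrable `[a, b] (EFin \o (fun t => `|g t|)).
  exact: integrable_norm.
pose D x y := F y * f y - F x * f x - \int[mu]_(t in `[x, y]) H t.
suff D0 : D a b = 0 by apply/eqP; rewrite -subr_eq0; apply/eqP.
apply: (@bisection_vanish D G a b (2 * L)) => //.
- move=> x m y ax xm my yb; rewrite /D (Rintegral_split H x m y)//; first by ring.
  exact: integrable_subitv iH.
- move=> x m y ax xm my yb; apply: Rintegral_split => //.
  exact: integrable_subitv ing.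
move=> x y ax xy yb.
have igx : mu.-integrable `[x, y] (EFin \o g) by exact: integrable_subitv gi.
have ingx : mu.-integrable `[x, y] (EFin \o (fun t => `|g t|)).
  exact: integrable_norm.
have iHx : mu.-integrable `[x, y] (EFin \o H) by exact: integrable_subitv iH.
have G0 s t : 0 <= G s t by apply: Rintegral_ge0.
have Zi (r : R) (h : R -> R) : mu.-integrable `[x, y] (EFin \o h) ->
    mu.-integrable `[x, y] (EFin \o (fun t => r * h t)).
  move=> hi; have := integrableZl (mu := mu) (measurable_itv _) r hi.
  by apply: eq_integrable => // t _.
have Di (h1 h2 : R -> R) : mu.-integrable `[x, y] (EFin \o h1) ->
    mu.-integrable `[x, y] (EFin \o h2) ->
    mu.-integrable `[x, y] (EFin \o (fun t => h1 t + h2 t)).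
  move=> hi1 hi2; have := integrableD (mu := mu) (measurable_itv _) hi1 hi2.
  by apply: eq_integrable => // t _.
have Bi (h1 h2 : R -> R) : mu.-integrable `[x, y] (EFin \o h1) ->
    mu.-integrable `[x, y] (EFin \o h2) ->
    mu.-integrable `[x, y] (EFin \o (fun t => h1 t - h2 t)).
  move=> hi1 hi2; have := integrableB (mu := mu) (measurable_itv _) hi1 hi2.
  by apply: eq_integrable => // t _.
have i1 : mu.-integrable `[x, y] (EFin \o (fun t => F y * g t + f x * F' t)).
  by apply: Di; apply: Zi.
have eD : D x y = \int[mu]_(t in `[x, y]) ((F y * g t + f x * F' t) - H t).
  rewrite RintegralB// RintegralD//; last 2 first.
  - exact: Zi.
  - exact: Zi.
  rewrite !RintegralZl// -(fg x y xy).2 -(FF' x y xy).2 /D.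
  by ring.
rewrite eD.
apply: le_trans (le_normr_Rintegral _ _) _ => //; first exact: Bi.
have i2 : mu.-integrable `[x, y] (EFin \o (fun t => L * (y - x) * `|g t| + L * G x y)).
  apply: Di; first exact: Zi.
  by apply: continuous_itv_integrable; exact: cst_continuous.
apply: (@le_trans _ _ (\int[mu]_(t in `[x, y]) (L * (y - x) * `|g t| + L * G x y))).
  apply: le_Rintegral => //.
    by apply: integrable_norm; exact: Bi.
  move=> t; rewrite /= in_itv /= => /andP[xt ty].
  have -> : F y * g t + f x * F' t - H t =
    (F y - F t) * g t + (f x - f t) * F' t by rewrite /H; ring.
  apply: le_trans (ler_normD _ _) _; rewrite !normrM; apply: lerD.
    apply: ler_wpM2r => //.
    have [c] := MVT_segment ty (fun z _ => dF z) (continuous_subspaceT cF).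
    rewrite in_itv /= => /andP[tc cy ->]; rewrite normrM; apply: ler_pM => //.
      by apply: hL; apply/andP; split; lra.
    by rewrite ger0_norm; lra.
  rewrite mulrC; apply: ler_pM => //; first by apply: hL; apply/andP; split; lra.
  rewrite distrC (fg x t xt).2.
  apply: le_trans (le_normr_Rintegral _ _) _ => //.
    exact: integrable_subitv igx.
  rewrite /G (Rintegral_split _ x t y)// lerDl; exact: G0.
rewrite RintegralD//; last 2 first.
- exact: Zi.
- by apply: continuous_itv_integrable; exact: cst_continuous.
rewrite RintegralZl// Rintegral_cst_itv// -/(G x y).
by rewrite le_eqVlt; apply/orP; left; apply/eqP; ring.
Qed.

End ProductRule.

(** * Integrals of derivatives over the line *)

Section IntegralOfDerivative.
Context {R : realType}.
Local Notation mu := (@lebesgue_measure R).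
Implicit Types (f g E : R -> R).

Lemma primitive_sub f (x y : R) : x <= y ->
  mu.-integrable [set: R] (EFin \o f) ->
  primitive f y - primitive f x = \int[mu]_(t in `[x, y]) f t.
Proof.
move=> xy fi.
rewrite /primitive (@Rintegral_itvB R f -oo%O (BRight y) x).
- by apply: Rintegral_itv_obnd_cbnd; apply: integrableS fi.
- by apply: integrableS fi.
- by [].
- by rewrite bnd_simp.
Qed.

(** If l were not zero, the integral of |E| over [x, x + 1] would eventually
    be at least |l| / 2, while it is an increment of a convergent primitive.
    The two hypotheses on F hold for both infinities: they express that F is
    invariant under translations and sees whole unit intervals. *)
Lemma integrable_limit_eq0 E (F : set_system R) (PF : ProperFilter F) (l p : R) :
  (forall s : R, x + s @[x --> F] --> F) ->
  (forall P : set R, F P -> F [set x | forall t, x <= t <= x + 1 -> P t]) ->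
  mu.-integrable [set: R] (EFin \o E) ->
  primitive (fun t => `|E t|) x @[x --> F] --> p ->
  E x @[x --> F] --> l -> l = 0.
Proof.
move=> shiftF unifF Ei Np El; apply/eqP/negPn/negP => l0.
have l1 : 0 < `|l| by rewrite normr_gt0.
pose N := primitive (fun t => `|E t|).
have Ni : mu.-integrable [set: R] (EFin \o (fun t => `|E t|)).
  exact: integrable_norm.
have lim0 : N (x + 1) - N x @[x --> F] --> (0 : R).
  rewrite -[X in _ --> X](subrr p); apply: cvgB => //.
  exact: (cvg_comp _ _ (shiftF 1) Np).
have big : F [set x | `|l| / 2 <= `|E x|].
  have := (cvgrPdist_lt _ _).1 El (`|l| / 2) ltac:(by lra).
  apply: filterS => x /= h; have := ler_distD (E x) l 0.
  by rewrite !subr0; lra.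
have : `|l| / 2 <= 0.
  apply: (cvgr_to_ge lim0); near=> x.
  have hx : forall t, x <= t <= x + 1 -> `|l| / 2 <= `|E t|.
    by near: x; exact: unifF.
  rewrite primitive_sub//; last by lra.
  apply: (@le_trans _ _ (\int[mu]_(t in `[x, x + 1]) (`|l| / 2))).
    by rewrite Rintegral_cst_itv; lra.
  have i1 : mu.-integrable `[x, x + 1] (EFin \o (fun=> `|l| / 2)).
    by apply: continuous_itv_integrable; exact: cst_continuous.
  have i2 : mu.-integrable `[x, x + 1] (EFin \o (fun t => `|E t|)).
    by apply: integrableS Ni.
  apply: (le_Rintegral (mu := mu) (measurable_itv _) i1 i2) => t.
  by rewrite /= in_itv /=; exact: hx.
by lra.
Unshelve. all: by end_near. Qed.

(** E has limits at both ends because g is integrable; they vanish because E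
    is integrable, and the integral of g is their difference. *)
Lemma Rintegral_derivative E g : ac_derivative E g ->
  mu.-integrable [set: R] (EFin \o E) -> mu.-integrable [set: R] (EFin \o g) ->
  \int[mu]_x g x = 0.
Proof.
move=> Eg Ei gi.
(* the limit of E at - oo *)
pose kap := E 0 - primitive g 0.
have e x : E x = kap + primitive g x.
  rewrite /kap; have [x0|/ltW x0] := leP 0 x.
    by have := primitive_sub g 0 x x0 gi; rewrite -(Eg 0 x x0).2; lra.
  by have := primitive_sub g x 0 x0 gi; rewrite -(Eg x 0 x0).2; lra.
have Ni : mu.-integrable [set: R] (EFin \o (fun t => `|E t|)).
  exact: integrable_norm.
have k0 : kap = 0.
  apply: (@integrable_limit_eq0 E -oo _ kap 0 shiftNy) => //.
  - move=> P [M [Mr MP]]; exists (M - 1); split; first exact: num_real.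
    by move=> x /= xM t /andP[_ tx]; apply: MP; lra.
  - exact: primitive_cvgNy.
  - rewrite (funext e : E = _) -[X in _ --> X]addr0; apply: cvgD; first exact: cvg_cst.
    exact: primitive_cvgNy.
apply: (@integrable_limit_eq0 E +oo _ _ (\int[mu]_x `|E x|) (@cvg_addrr R)) => //.
- move=> P [M [Mr MP]]; exists M; split=> // x /= xM t /andP[tx _].
  by apply: MP; exact: lt_le_trans tx.
- exact: primitive_cvgy.
- rewrite (funext e : E = _) -[X in _ --> X]add0r k0; apply: cvgD; first exact: cvg_cst.
  exact: primitive_cvgy.
Qed.

End IntegralOfDerivative.

(** * Nonnegativity of the factorized operator *)

Section Nonnegativity.
Context {R : realType}.
Local Notation C := R[i].
Local Notation reC := (@complex.Re R).
Local Notation imC := (@complex.Im R).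
Local Notation mu := (@lebesgue_measure R).
Local Notation intR f := (mu.-integrable [set: R] (EFin \o f)).
Implicit Types (f g h E : R -> R).

Lemma integrableRD f g : intR f -> intR g -> intR (fun x => f x + g x).
Proof.
move=> fi gi; have := integrableD (mu := mu) measurableT fi gi.
by apply: eq_integrable => // x _.
Qed.

Lemma integrableRB f g : intR f -> intR g -> intR (fun x => f x - g x).
Proof.
move=> fi gi; have := integrableB (mu := mu) measurableT fi gi.
by apply: eq_integrable => // x _.
Qed.

Lemma L2_mul_integrable f g : f \in Lfun mu 2%:E -> g \in Lfun mu 2%:E ->
  intR (fun x => f x * g x).
Proof. by move=> f2 g2; apply/Lfun1_integrable; exact: Lfun2_mul_Lfun1. Qed.

Lemma ac_derivativeD E1 E2 g1 g2 : ac_derivative E1 g1 -> ac_derivative E2 g2 ->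
  ac_derivative (fun x => E1 x + E2 x) (fun x => g1 x + g2 x).
Proof.
move=> h1 h2 a b ab; have [i1 e1] := h1 a b ab; have [i2 e2] := h2 a b ab.
split.
  have := integrableD (mu := mu) (measurable_itv _) i1 i2.
  by apply: eq_integrable => // x _.
by rewrite RintegralD// -e1 -e2; ring.
Qed.

Lemma ac_derivativeB E1 E2 g1 g2 : ac_derivative E1 g1 -> ac_derivative E2 g2 ->
  ac_derivative (fun x => E1 x - E2 x) (fun x => g1 x - g2 x).
Proof.
move=> h1 h2 a b ab; have [i1 e1] := h1 a b ab; have [i2 e2] := h2 a b ab.
split.
  have := integrableB (mu := mu) (measurable_itv _) i1 i2.
  by apply: eq_integrable => // x _.
by rewrite RintegralB// -e1 -e2; ring.
Qed.

Variables (w w' : R -> R) (M : R).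
Hypothesis dw : forall x : R, is_derive x (1 : R) w (w' x).
Hypothesis cw' : continuous w'.
Hypothesis wM : forall x, `|w x| <= M.
Hypothesis w'M : forall x, `|w' x| <= M.

Let cw : continuous w. Proof. exact: is_derive_continuous dw. Qed.

Let bounded_mul (B f : R -> R) (b : R) : continuous B -> (forall x, `|B x| <= b) ->
  intR f -> intR (fun x => B x * f x).
Proof.
move=> cB Bb fi.
have Bb' t : [set: R] t -> `|B t| <= b by move=> _; exact: Bb.
apply: (integrable_bounded_mul B f _ b measurableT _ Bb' fi).
exact: continuous_measurable_fun.
Qed.

(** With E = w f ^ 2 + f f' and g its derivative, f * H f = (f' + w f) ^ 2 -
    g, and the integral of g is zero. *)
Lemma factorized_form f f1 f2 : ac_derivative f f1 -> ac_derivative f1 f2 ->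
  f \in Lfun mu 2%:E -> f1 \in Lfun mu 2%:E -> f2 \in Lfun mu 2%:E ->
  intR (fun x => f x * (- f2 x - (w' x - w x ^+ 2) * f x)) /\
  \int[mu]_x (f x * (- f2 x - (w' x - w x ^+ 2) * f x)) =
  \int[mu]_x (f1 x + w x * f x) ^+ 2.
Proof.
move=> ff1 f12 Lf Lf1 Lf2.
have cf1 := ac_derivative_continuous _ _ f12.
have df := ac_derivative_is_derive _ _ ff1 cf1.
have cf := is_derive_continuous _ _ df.
have i00 := L2_mul_integrable _ _ Lf Lf; have i01 := L2_mul_integrable _ _ Lf Lf1.
have i11 := L2_mul_integrable _ _ Lf1 Lf1; have i02 := L2_mul_integrable _ _ Lf Lf2.
have wi h : intR h -> intR (fun x => w x * h x) by exact: (bounded_mul _ _ _ cw wM).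
have w'i h : intR h -> intR (fun x => w' x * h x).
  exact: (bounded_mul _ _ _ cw' w'M).
pose E x := w x * f x * f x + f x * f1 x.
pose g x := ((w' x * f x + w x * f1 x) * f x + w x * f x * f1 x) +
            (f1 x * f1 x + f x * f2 x).
have Eg : ac_derivative E g.
  apply: ac_derivativeD; apply: ac_derivative_mul => //.
    move=> x; apply: (@is_derive_eq _ _ _ _ _ _ _ _ (is_deriveM (dw x) (df x))).
    by rewrite /GRing.scale /=; ring.
  by move=> x; apply: cvgD; apply: cvgM;
    [exact: cw' | exact: cf | exact: cw | exact: cf1].
have Ei : intR E.
  have := integrableRD _ _ (wi _ i00) i01.
  by apply: eq_integrable => // x _; rewrite /E /= mulrA.
have gi : intR g.
  have := integrableRD _ _ (integrableRD _ _ (w'i _ i00)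
    (integrableRD _ _ (wi _ i01) (wi _ i01))) (integrableRD _ _ i11 i02).
  by apply: eq_integrable => // x _; rewrite /g /=; congr EFin; ring.
have si : intR (fun x => (f1 x + w x * f x) ^+ 2).
  have := integrableRD _ _ i11 (integrableRD _ _ (integrableRD _ _ (wi _ i01) (wi _ i01))
    (wi _ (wi _ i00))).
  by apply: eq_integrable => // x _ /=; congr EFin; ring.
have e x : f x * (- f2 x - (w' x - w x ^+ 2) * f x) =
    (f1 x + w x * f x) ^+ 2 - g x by rewrite /g; ring.
rewrite (funext e); split; first exact: integrableRB.
by rewrite RintegralB// (Rintegral_derivative _ _ Eg Ei gi) subr0.
Qed.

(** The integrand is the derivative of h * f' - f * h'; this makes the
    imaginary part of the quadratic form vanish. *)
Lemma symmetric_form f f1 f2 h h1 h2 :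
  ac_derivative f f1 -> ac_derivative f1 f2 ->
  ac_derivative h h1 -> ac_derivative h1 h2 ->
  f \in Lfun mu 2%:E -> f1 \in Lfun mu 2%:E -> f2 \in Lfun mu 2%:E ->
  h \in Lfun mu 2%:E -> h1 \in Lfun mu 2%:E -> h2 \in Lfun mu 2%:E ->
  \int[mu]_x (h x * f2 x - f x * h2 x) = 0.
Proof.
move=> ff1 f12 hh1 h12 Lf Lf1 Lf2 Lh Lh1 Lh2.
have cf1 := ac_derivative_continuous _ _ f12.
have df := ac_derivative_is_derive _ _ ff1 cf1.
have ch1 := ac_derivative_continuous _ _ h12.
have dh := ac_derivative_is_derive _ _ hh1 ch1.
apply: (Rintegral_derivative (fun x => h x * f1 x - f x * h1 x)).
- have := ac_derivativeB _ _ _ _ (ac_derivative_mul _ _ _ _ dh ch1 f12)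
    (ac_derivative_mul _ _ _ _ df cf1 h12).
  by congr ac_derivative; apply/funext => x; ring.
- by apply: integrableRB; exact: L2_mul_integrable.
- by apply: integrableRB; exact: L2_mul_integrable.
Qed.

Lemma schrodinger_nonnegative :
  nonnegative_operator (schrodinger (fun x => w' x - w x ^+ 2)).
Proof.
move=> u v [u1 [u2 [[[ar ai] [ar1 ai1] [Lr Li] [Lr1 Li1] [Lr2 Li2]] ->]]].
have [ir er] := factorized_form _ _ _ ar ar1 Lr Lr1 Lr2.
have [ii ei] := factorized_form _ _ _ ai ai1 Li Li1 Li2.
have es := symmetric_form _ _ _ _ _ _ ar ar1 ai ai1 Lr Lr1 Lr2 Li Li1 Li2.
rewrite /inner /cintegral lecE /=; apply/andP; split.
  apply/eqP; rewrite -[RHS]es; apply: eq_Rintegral => x _.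
  rewrite !Re_ImE /=; case: (u x) => a b /=; ring.
set J := (X in 0 <= X); suff -> : J =
  \int[mu]_x ((reC \o u1) x + w x * (reC \o u) x) ^+ 2 +
  \int[mu]_x ((imC \o u1) x + w x * (imC \o u) x) ^+ 2.
  by apply: addr_ge0; apply: Rintegral_ge0 => x _; exact: sqr_ge0.
rewrite -er -ei -RintegralD//; apply: eq_Rintegral => x _.
rewrite !Re_ImE /=; case: (u x) => a b /=; ring.
Qed.

End Nonnegativity.

(** * Schwartz potentials and the theorem *)

(** Adding the seminorms with weights 1 and |x| ^ 2, respectively |x| and
    |x| ^ 3, yields the factor 1 + x ^ 2. A single constant serves all
    bounds. *)
Lemma schwartz_bounds (R : realType) (w : R -> R) : schwartz w ->
  exists c, [/\ decays c w, decays c (fun x => x * w x),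
    forall x, `|w x| <= c & forall x, `|derive1 w x| <= c].
Proof.
move=> [_ bnd].
have [C0 h0] := bnd 0%N 0%N; have [C1 h1] := bnd 1%N 0%N.
have [C2 h2] := bnd 2%N 0%N; have [C3 h3] := bnd 3%N 0%N.
have [C4 h4] := bnd 0%N 1%N.
have ge0 (D : R) (m n : nat) : (forall x, `|x| ^+ m * `|derive1n n w x| <= D) -> 0 <= D.
  by move=> h; apply: le_trans (h 0); rewrite mulr_ge0// exprn_ge0.
have p0 := ge0 _ _ _ h0; have p1 := ge0 _ _ _ h1; have p2 := ge0 _ _ _ h2.
have p3 := ge0 _ _ _ h3; have p4 := ge0 _ _ _ h4.
have pos (x : R) : 0 < 1 + x ^+ 2 by rewrite ltr_pwDl// sqr_ge0.
exists (C0 + C1 + C2 + C3 + C4); split=> x.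
- rewrite ler_pdivlMr//; have := h0 x; have := h2 x; rewrite /= expr0 mul1r.
  by rewrite real_normK ?num_real//; lra.
- rewrite ler_pdivlMr// normrM; have := h1 x; have := h3 x.
  rewrite /= expr1 exprS real_normK ?num_real// -mulrA.
  move: (`|x|) (`|w x|) (x ^+ 2) => a b d; lra.
- by have := h0 x; rewrite /= expr0 mul1r; lra.
- by have := h4 x; rewrite /= expr0 mul1r; lra.
Qed.

Theorem theorem1 (R : realType) (w : R -> R) (hw : schwartz w) :
  let q : R -> R := fun x => derive1 w x - w x ^+ 2 in
  let I : R := \int[lebesgue_measure]_x w x in
  nonnegative_operator (schrodinger q) /\
  linearly_dependent (jost_minus q 0) (jost_plus q 0) /\
  (coef_a q k @[k --> 0^'] --> ((cosh I)%:C : R[i]^o)) /\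
  (coef_b q k @[k --> 0^'] --> ((- sinh I)%:C : R[i]^o)) /\
  (transmission q k @[k --> 0^'] --> ((sech I)%:C : R[i]^o)) /\
  (reflection q k @[k --> 0^'] --> ((- tanh I)%:C : R[i]^o)).
Proof.
have [c [decay0 decay1 wc w'c]] := schwartz_bounds _ _ hw.
have dw (x : R) : is_derive x (1 : R) w (derive1 w x).
  by rewrite derive1E; apply: derivableP; exact: hw.1 0%N x.
have cw' : continuous (derive1 w).
  move=> x; apply/differentiable_continuous/derivable1_diffP.
  exact: hw.1 1%N x.
have [ha hb] := scattering_cvg w (derive1 w) c dw decay0 decay1.
have [hT hR] := transmission_reflection_cvg w (derive1 w) c dw decay0 decay1.
split; first exact: schrodinger_nonnegative dw cw' wc w'c.
split; first exact: zero_energy_linearly_dependent dw decay0.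
exact (conj ha (conj hb (conj hT hR))).
Qed.
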